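(* Let $\Omega\subsetneq\mathbb{C}$ be a simply connected Smirnov domain which is exceptional (in the weak sense), and let $h:\mathbb{D}\to\Omega$ be a conformal map. If $h'$ (which is rational) has exactly two poles on $\partial\mathbb{D}$, then, up to similarity, $\Omega$ is the image of the strip $\{w:|\Im w|<\pi/2\}$ under the conformal map $g(w)=w+\sinh(w)$, and the analytic completion $f=u+iv$ of the roof function $u$ satisfies (after the same similarity and up to a positive multiple and an additive imaginary constant) $f(g(w))=\cosh(w)$.
   Context: $\Omega$ is exceptional in the weak sense if there is a positive harmonic function $u$ on $\Omega$ whose boundary values are $0$ and whose normal derivative is a nonzero constant almost everywhere with respect to arclength on $\partial\Omega$; its analytic completion is $f=u+iv$ with $v$ a harmonic conjugate. $\Omega$ is Smirnov if $h'$ is an outer function (no singular inner factor in its canonical factorization). *)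

(* Defs.v *)
From HB Require Import structures.
From mathcomp Require Import all_boot all_order all_algebra.
From mathcomp Require Import all_classical all_reals all_analysis.
From mathcomp.real_closed Require Import complex.
Import Order.TTheory GRing.Theory Num.Theory.
Import numFieldNormedType.Exports.

Set Implicit Arguments.
Unset Strict Implicit.
Unset Printing Implicit Defensive.

Local Open Scope classical_set_scope.
Local Open Scope ring_scope.
Local Open Scope complex_scope.

(* R[i] viewed as a normed module over itself, so that [derivable f z 1]
   and [derive1 f z] for f : R[i] -> R[i] are complex (C-)differentiability
   and the complex derivative. *)
#[non_forgetful_inheritance]
HB.instance Definition _ (R : rcfType) := GRing.ComAlgebra.copy R[i] (R[i])^o.
#[non_forgetful_inheritance]
HB.instance Definition _ (R : rcfType) := NormedModule.copy R[i] (R[i])^o.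

Section ComplexDefs.
Variable R : realType.
Local Notation C := R[i].

Definition cmod (z : C) : R :=
  Num.sqrt (complex.Re z ^+ 2 + complex.Im z ^+ 2).

Definition unit_disk : set C := [set z | cmod z < 1].

Definition expi (t : R) : C := Complex (cos t) (sin t).

Definition cexp (z : C) : C := (expR (complex.Re z))%:C * expi (complex.Im z).
Definition csinh (w : C) : C := (cexp w - cexp (- w)) / 2.
Definition ccosh (w : C) : C := (cexp w + cexp (- w)) / 2.

Definition holomorphic_on (U : set C) (f : C -> C) : Prop :=
  open U /\ forall z, U z -> derivable f z 1.

Definition conformal_map_onto (h : C -> C) (Om : set C) : Prop :=
  holomorphic_on unit_disk h /\
  (forall z w, unit_disk z -> unit_disk w -> h z = h w -> z = w) /\
  h @` unit_disk = Om.

Definition pdx (u : C -> R) (z : C) : R := derive1 (fun t : R => u (z + t%:C)) 0.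
Definition pdy (u : C -> R) (z : C) : R :=
  derive1 (fun t : R => u (z + Complex 0 t)) 0.

Definition has_partials (F : C -> R) (z : C) : Prop :=
  derivable (fun t : R => F (z + t%:C)) 0 1 /\
  derivable (fun t : R => F (z + Complex 0 t)) 0 1.

Definition harmonic_on (U : set C) (u : C -> R) : Prop :=
  open U /\
  forall z, U z ->
    [/\ has_partials u z, has_partials (pdx u) z, has_partials (pdy u) z,
        [/\ {for z, continuous u}, {for z, continuous (pdx u)},
            {for z, continuous (pdy u)}, {for z, continuous (pdx (pdx u))}
          & [/\ {for z, continuous (pdy (pdx u))},
                {for z, continuous (pdx (pdy u))}
              & {for z, continuous (pdy (pdy u))}]]
      & pdx (pdx u) z + pdy (pdy u) z = 0].

Definition dir_deriv (u : C -> R) (w n : C) : R :=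
  derive1 (fun s : R => u (w + s%:C * n)) 0.

(* "almost every point e^{it} of the unit circle" (Lebesgue measure in t;
   the predicates below are 2pi-periodic in t) *)
Definition ae_circle (P : R -> Prop) : Prop :=
  {ae (@lebesgue_measure R), forall t : R, P t}.

Definition boundary_value (h : C -> C) (u : C -> R) (t l : R) : Prop :=
  (fun r : R => u (h (r%:C * expi t))) @ at_left 1 --> l.

(* Outward normal derivative of u at the boundary point corresponding to
   e^{it}: limit as r -> 1- of the derivative of u in the direction of the
   outward unit normal e^{it} h'(r e^{it}) / |h'(r e^{it})| to the level
   curve h({|z| = r}). *)
Definition normal_derivative (h : C -> C) (u : C -> R) (t l : R) : Prop :=
  (fun r : R =>
     dir_deriv u (h (r%:C * expi t))
       (expi t * derive1 h (r%:C * expi t)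
          / (cmod (derive1 h (r%:C * expi t)))%:C))
    @ at_left 1 --> l.

Definition roof_function (Om : set C) (h : C -> C) (u : C -> R) : Prop :=
  [/\ harmonic_on Om u,
      (forall z, Om z -> 0 < u z),
      ae_circle (fun t => boundary_value h u t 0)
    & exists c : R, c != 0 /\ ae_circle (fun t => normal_derivative h u t c)].

Definition herglotz (phi : R -> R) (z : C) : C :=
  let k t := (expi t + z) / (expi t - z) in
  Complex
    ((2 * pi)^-1 * Rintegral (@lebesgue_measure R) `[0, 2 * pi]
        (fun t => complex.Re (k t) * phi t))
    ((2 * pi)^-1 * Rintegral (@lebesgue_measure R) `[0, 2 * pi]
        (fun t => complex.Im (k t) * phi t)).

Definition outer_function (F : C -> C) : Prop :=
  exists (lam : C) (phi : R -> R),
    [/\ cmod lam = 1,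
        (@lebesgue_measure R).-integrable `[0, 2 * pi] (EFin \o phi)
      & forall z, unit_disk z -> F z = lam * cexp (herglotz phi z)].

Definition smirnov (h : C -> C) : Prop := outer_function (derive1 h).

Definition rational_deriv_two_boundary_poles (h : C -> C) : Prop :=
  exists P Q : {poly C},
    [/\ Q != 0, coprimep P Q,
        (forall z, unit_disk z -> derive1 h z = P.[z] / Q.[z])
      & exists a b : C,
          [/\ a != b, cmod a = 1 /\ cmod b = 1, root Q a, root Q b
            & forall z, cmod z = 1 -> root Q z -> z = a \/ z = b]].

Definition strip : set C := [set w | `|complex.Im w| < pi / 2].
Definition gmap (w : C) : C := w + csinh w.

End ComplexDefs.

(* Main.v *)
(* Let F = f o h on the disk and U = Re F > 0.  By the Schwarz-Pick form of
   Harnack's inequality, U(re)(1+r)/(1-r) increases with r on every radius; where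
   U -> 0 and the normal derivative tends to c, its limit is -2c|h'(e)|.  Hence
   U(re) <= -2c|h'(e)|(1-r)/(1+r) for almost every e, and by continuity for every e
   other than the two poles a, b of h' = P/Q.  So the measures U(rho e)|de| lose
   their mass away from a and b as rho -> 1, and Poisson's formula gives
   U = alpha P_a + beta P_b with P_a, P_b the Poisson kernels at a and b.  The
   normal derivative is then explicit on the circle:
   -c|h'(e)| = 2 (alpha/|e-a|^2 + beta/|e-b|^2).  As h' has neither zeros nor poles
   in the disk, it is determined up to a constant by its modulus on the circle,
   and h' = k L^2/((z-a)^2(z-b)^2) with L affine; both weights are positive because
   both poles occur.  In the coordinate w of the strip with z = mu(e^w), where mu
   maps the right half plane to the disk and infinity, 0 to a, b, this reads
   dh/dw = A(1 + cosh w) and F = c' cosh w + i d.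

   Poisson's formula is used in a discrete form, with averages over roots of
   unity in place of integrals. *)

Require Import Defs.
From HB Require Import structures.
From mathcomp Require Import all_boot all_order all_algebra.
From mathcomp Require Import all_classical all_reals all_analysis.
From mathcomp.real_closed Require Import complex.
From mathcomp Require Import ring lra zify.
Set Implicit Arguments.
Unset Strict Implicit.
Unset Printing Implicit Defensive.
Import Order.TTheory GRing.Theory Num.Theory.
Import numFieldNormedType.Exports.
Local Open Scope classical_set_scope.
Local Open Scope ring_scope.
Local Open Scope complex_scope.

(** * The complex modulus *)

(** The boundary hypotheses are radial and hold only almost everywhere, so by themselves they do not
    exclude a singular part of the boundary measure of U. Harnack's inequality turns them into a
    bound at a fixed radius r < 1, where both sides are continuous in e. The masses near a and b
    then converge without passing to subsequences: the kernels P_a and P_b are equal at 0 and differ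
    at b/2, so the values of U at these two points determine both masses. The factor L is a spectral
    factor: alpha |e-b|^2 + beta |e-a|^2 is a positive trigonometric polynomial of degree one, hence
    a multiple of |L(e)|^2 with L affine and zero-free in the disk. The scale of mu is a free
    parameter tau > 0. With tau^2 = alpha / (beta |a-b|^2) the coefficients of e^w and e^-w in F
    coincide, which makes F a cosh, and the zero of L falls at e^w = -1, which makes dh/dw
    proportional to 2 + e^w + e^-w. *)

Section Modulus.
Variable R : realType.
Local Notation C := R[i].
Implicit Types z w : C.

Lemma cmodE z : `|z| = (cmod z)%:C.
Proof. exact: normc_def. Qed.

Lemma cmod_ge0 z : 0 <= cmod z.
Proof. exact: sqrtr_ge0. Qed.

Lemma cmodM z w : cmod (z * w) = cmod z * cmod w.
Proof. by apply: complexI; rewrite rmorphM /= -!cmodE normrM. Qed.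

Lemma cmodV z : cmod z^-1 = (cmod z)^-1.
Proof. by apply: complexI; rewrite fmorphV /= -!cmodE normfV. Qed.

Lemma cmodX z n : cmod (z ^+ n) = cmod z ^+ n.
Proof. by apply: complexI; rewrite rmorphXn /= -!cmodE normrX. Qed.

Lemma cmodN z : cmod (- z) = cmod z.
Proof. by apply: complexI; rewrite -!cmodE normrN. Qed.

Lemma cmodB z w : cmod (z - w) = cmod (w - z).
Proof. by rewrite -cmodN opprB. Qed.

Lemma cmod_conj z : cmod (conjc z) = cmod z.
Proof. by apply: complexI; rewrite -!cmodE normcJ. Qed.

Lemma cmod0 : cmod (0 : C) = 0.
Proof. by apply: complexI; rewrite -cmodE normr0. Qed.

Lemma cmod1 : cmod (1 : C) = 1.
Proof. by apply: complexI; rewrite -cmodE normr1. Qed.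

Lemma cmod_eq0 z : (cmod z == 0) = (z == 0).
Proof. by rewrite -(inj_eq (@complexI R)) -cmodE normr_eq0. Qed.

Lemma cmod_gt0 z : (0 < cmod z) = (z != 0).
Proof. by rewrite lt_def cmod_ge0 andbT cmod_eq0. Qed.

Lemma cmodD z w : cmod (z + w) <= cmod z + cmod w.
Proof. by rewrite -lecR rmorphD /= -!cmodE ler_normD. Qed.

Lemma cmod_distB z w : `|cmod z - cmod w| <= cmod (z - w).
Proof.
have := cmodD (z - w) w; have := cmodD (w - z) z.
rewrite !subrK cmodB => h1 h2; rewrite ler_norml; apply/andP; split; lra.
Qed.

Lemma cmod_sum (I : Type) (r : seq I) (P : pred I) (f : I -> C) :
  cmod (\sum_(i <- r | P i) f i) <= \sum_(i <- r | P i) cmod (f i).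
Proof.
elim/big_ind2 : _ => [|x1 x2 y1 y2 h1 h2|//]; first by rewrite cmod0.
exact: le_trans (cmodD _ _) (lerD h1 h2).
Qed.

Lemma cmodR (x : R) : cmod x%:C = `|x|.
Proof. by rewrite /cmod /= expr0n addr0 sqrtr_sqr. Qed.

Lemma sqr_cmod z : cmod z ^+ 2 = complex.Re z ^+ 2 + complex.Im z ^+ 2.
Proof. by rewrite sqr_sqrtr // addr_ge0 // sqr_ge0. Qed.

Lemma sqr_cmodC z : (cmod z ^+ 2)%:C = z * (conjc z).
Proof. by rewrite rmorphXn /= -cmodE sqr_normc. Qed.

Lemma normRe_le z : `|complex.Re z| <= cmod z.
Proof.
by rewrite -(ler_pXn2r (_ : 0 < 2)%N) ?nnegrE ?cmod_ge0 // sqr_cmod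
  real_normK ?num_real // lerDl sqr_ge0.
Qed.

Lemma normIm_le z : `|complex.Im z| <= cmod z.
Proof.
by rewrite -(ler_pXn2r (_ : 0 < 2)%N) ?nnegrE ?cmod_ge0 // sqr_cmod
  real_normK ?num_real // lerDr sqr_ge0.
Qed.

Lemma circle_neq0 z : cmod z = 1 -> z != 0.
Proof. by move=> z1; rewrite -cmod_eq0 z1 oner_eq0. Qed.

Lemma circle_disk_neq w z : cmod w = 1 -> cmod z < 1 -> z != w.
Proof. by move=> w1 z1; apply/eqP => E; move: z1; rewrite E w1 ltxx. Qed.

Lemma conjc_circle z : cmod z = 1 -> conjc z = z^-1.
Proof.
move=> z1; apply: (mulfI (circle_neq0 z1)).
by rewrite -sqr_cmodC z1 expr1n mulfV // circle_neq0.
Qed.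

Lemma cmod_le_ReIm z : cmod z <= `|complex.Re z| + `|complex.Im z|.
Proof.
case: z => x y; have xyE : x +i* y = x%:C + (0 +i* 1) * y%:C.
  by apply/eqP; rewrite eq_complex /=; apply/andP; split; apply/eqP; ring.
rewrite {1}xyE; apply: le_trans (cmodD _ _) _; rewrite cmodM !cmodR.
have -> : cmod (0 +i* 1 : C) = 1 by rewrite /cmod /= expr0n add0r expr1n sqrtr1.
by rewrite mul1r.
Qed.

Lemma conjcB z w : conjc (z - w) = conjc z - conjc w.
Proof. exact: rmorphB. Qed.

Lemma conjcM z w : conjc (z * w) = conjc z * conjc w.
Proof. exact: rmorphM. Qed.

Lemma ReD z w : complex.Re (z + w) = complex.Re z + complex.Re w.
Proof. by case: z w => ? ? [] ? ?. Qed.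

Lemma ReN z : complex.Re (- z) = - complex.Re z.
Proof. by case: z. Qed.

Lemma ReB z w : complex.Re (z - w) = complex.Re z - complex.Re w.
Proof. by rewrite ReD ReN. Qed.

Lemma ImB z w : complex.Im (z - w) = complex.Im z - complex.Im w.
Proof. by case: z w => ? ? [] ? ?. Qed.

Lemma ReZ (x : R) z : complex.Re (x%:C * z) = x * complex.Re z.
Proof. by case: z => a b /=; rewrite mul0r subr0. Qed.

Lemma Re_sum (I : Type) (r : seq I) (P : pred I) (f : I -> C) :
  complex.Re (\sum_(i <- r | P i) f i) = \sum_(i <- r | P i) complex.Re (f i).
Proof. by elim/big_rec2 : _ => // i x y _ <-; rewrite ReD. Qed.

(** Take for [c] the conjugate of [z] divided by its modulus. This duality carries the real mean
    value theorem over to complex-valued functions. *)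
Lemma cmod_leP (M : R) z :
  (forall c : C, cmod c = 1 -> complex.Re (c * z) <= M) -> cmod z <= M.
Proof.
move=> H; have [z0|z0] := eqVneq z 0.
  by have := H 1 cmod1; rewrite z0 mulr0 cmod0.
have m0 : 0 < cmod z by rewrite cmod_gt0.
have := H ((conjc z) / (cmod z)%:C).
rewrite cmodM cmod_conj cmodV cmodR ger0_norm ?cmod_ge0 // divff ?gt_eqF //.
move=> /(_ erefl); rewrite mulrAC [(conjc z) * z]mulrC -sqr_cmodC -fmorphV -rmorphM /=.
by rewrite expr2 mulfK // gt_eqF.
Qed.

(** The norm of [R[i]] takes its values in [R[i]], so the radius of a ball is a complex number; its
    positivity forces the imaginary part to be 0. From here on all radii are real. *)
Lemma nbhsCP (z : C) (A : set C) :
  nbhs z A <-> exists2 d : R, 0 < d & forall w, cmod (w - z) < d -> A w.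
Proof.
split=> [/nbhs_normP[[x y]/= e0 H]|[d d0 H]].
  move: e0; rewrite ltcE /= => /andP[/eqP y0 x0]; subst y.
  exists x => // w wz; apply: H => /=.
  by rewrite /ball_ /= distrC cmodE ltcR.
apply/nbhs_normP; exists d%:C => /=; first by rewrite ltcR.
by move=> w; rewrite /ball_ /= distrC cmodE ltcR; exact: H.
Qed.

Lemma continuousCP (f : C -> C) z : {for z, continuous f} <->
  forall e : R, 0 < e -> exists2 d : R, 0 < d &
    forall w, cmod (w - z) < d -> cmod (f w - f z) < e.
Proof.
split=> [H e e0|H].
  have /nbhsCP : nbhs z (f @^-1` [set w | cmod (w - f z) < e]).
    by apply: H; apply/nbhsCP; exists e.
  by [].
by move=> A /nbhsCP[e e0 HA]; apply/nbhsCP; have [d d0 Hd] := H e e0; exists d => // w /Hd/HA.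
Qed.

Lemma continuousRP (f : C -> R) z : {for z, continuous f} <->
  forall e : R, 0 < e -> exists2 d : R, 0 < d &
    forall w, cmod (w - z) < d -> `|f w - f z| < e.
Proof.
split=> [H e e0|H].
  have /nbhsCP : nbhs z (f @^-1` [set w | `|w - f z| < e]).
    apply: H; apply/nbhs_normP; exists e => // w.
    by rewrite /ball_ /= distrC.
  by [].
move=> A /nbhs_normP[e e0 HA]; apply/nbhsCP; have [d d0 Hd] := H e e0.
by exists d => // w /Hd Hw; apply: HA; rewrite /= distrC.
Qed.

Lemma openC_ball (U : set C) z : open U -> U z ->
  exists2 d : R, 0 < d & forall w, cmod (w - z) < d -> U w.
Proof. by rewrite openE => oU /oU /nbhsCP. Qed.

Lemma ccont_cst (k z : C) : {for z, continuous (fun=> k : C)}.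
Proof. exact: cst_continuous. Qed.

Lemma ccont_id (z : C) : {for z, continuous (fun w : C => w)}.
Proof. by apply/continuousCP => e e0; exists e. Qed.

Lemma ccontD (f g : C -> C) z : {for z, continuous f} -> {for z, continuous g} ->
  {for z, continuous (fun w => f w + g w)}.
Proof. exact: continuousD. Qed.

Lemma ccontM (f g : C -> C) z : {for z, continuous f} -> {for z, continuous g} ->
  {for z, continuous (fun w => f w * g w)}.
Proof. exact: continuousM. Qed.

Lemma ccontV (f : C -> C) z : f z != 0 -> {for z, continuous f} ->
  {for z, continuous (fun w => (f w)^-1)}.
Proof. by move=> f0 cf; apply: continuousV. Qed.

Lemma ccont_comp (f g : C -> C) z : {for z, continuous f} -> {for f z, continuous g} ->
  {for z, continuous (fun w => g (f w))}.
Proof. exact: continuous_comp. Qed.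

Lemma ccontN (f : C -> C) z : {for z, continuous f} -> {for z, continuous (fun w => - f w)}.
Proof. exact: continuousN. Qed.

Lemma continuous_cmod z : {for z, continuous (@cmod R)}.
Proof.
by apply/continuousRP => e e0; exists e => // w; apply: le_lt_trans; exact: cmod_distB.
Qed.

Lemma continuous_Re z : {for z, continuous (@complex.Re R)}.
Proof.
apply/continuousRP => e e0; exists e => // w.
by apply: le_lt_trans; rewrite -ReB; exact: normRe_le.
Qed.

End Modulus.

(** * Complex differentiation *)

Section ComplexDerivative.
Variable R : realType.
Local Notation C := R[i].
Implicit Types (f g : C -> C) (z w l m : C).

(* Caratheodory's form of the complex derivative, which turns the rules of
   calculus into continuity of the slope function. *)
Definition cder f z l := exists phi : C -> C,
  [/\ {for z, continuous phi}, phi z = l & forall w, f w = f z + phi w * (w - z)].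

Lemma cder_slopeP f z l : {for z,
  continuous (fun w => if w == z then l else (f w - f z) / (w - z))} <->
  cder f z l.
Proof.
split=> [cphi|[phi [cphi phiz phiE]]].
  exists (fun w => if w == z then l else (f w - f z) / (w - z)).
  split=> //; first by rewrite eqxx.
  move=> w; case: eqVneq => [->|wz]; first by rewrite subrr mulr0 addr0.
  by rewrite divfK ?subr_eq0// addrC subrK.
have -> // : (fun w => if w == z then l else (f w - f z) / (w - z)) = phi.
apply/funext => w; case: eqVneq => [->//|wz].
by rewrite (phiE w) addrAC subrr add0r mulfK // subr_eq0.
Qed.

Lemma cderP f z l : cder f z l <-> forall e : R, 0 < e -> exists2 d : R, 0 < d &
  forall w, cmod (w - z) < d -> cmod (f w - f z - l * (w - z)) <= e * cmod (w - z).
Proof.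
split=> [[phi [cphi phiz phiE]] e e0|H].
  have [d d0 Hd] := iffLR (continuousCP _ _) cphi e e0; exists d => // w /Hd H.
  rewrite (phiE w) [f z + _]addrC addrK -mulrBl cmodM -phiz.
  by rewrite ler_wpM2r ?cmod_ge0 // ltW.
apply/cder_slopeP/continuousCP => e e0.
have [d d0 Hd] := H _ (divr_gt0 e0 (ltr0n _ 2)); exists d => // w wz /=.
rewrite eqxx; case: eqVneq => [_|wz0]; first by rewrite subrr cmod0.
have m0 : 0 < cmod (w - z) by rewrite cmod_gt0 subr_eq0.
have -> : (f w - f z) / (w - z) - l = (f w - f z - l * (w - z)) / (w - z).
  by field; rewrite subr_eq0.
rewrite cmodM cmodV ltr_pdivrMr //; apply: (le_lt_trans (Hd w wz)).
by rewrite ltr_pM2r //; lra.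
Qed.

Lemma cder_continuous f z l : cder f z l -> {for z, continuous f}.
Proof.
case=> phi [cphi _ phiE]; rewrite (funext phiE).
exact (ccontD (@ccont_cst R (f z) z) (ccontM cphi (ccontD (@ccont_id R z) (@ccont_cst R
  (- z) z)))).
Qed.

Lemma cder_near f g z l : (exists2 d : R, 0 < d & forall w, cmod (w - z) < d -> f w = g w) ->
  cder f z l -> cder g z l.
Proof.
move=> [d d0 fg] /cderP H; apply/cderP => e /H [d' d'0 Hd'].
exists (Num.min d d') => [|w]; first by rewrite lt_min d0.
rewrite lt_min => /andP[/fg <- /Hd']; rewrite -fg //.
by rewrite subrr cmod0.
Qed.

Lemma cder_cst (k : C) z : cder (fun=> k) z 0.
Proof. by exists (fun=> 0); split=> [|//|w]; [exact: ccont_cst|rewrite mul0r addr0]. Qed.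

Lemma cder_id z : cder id z 1.
Proof.
by exists (fun=> 1); split=> [|//|w]; [exact: ccont_cst|rewrite mul1r addrC subrK].
Qed.

Lemma cderD f g z l m : cder f z l -> cder g z m -> cder (fun w => f w + g w) z (l + m).
Proof.
move=> [p [cp <- pE]] [q [cq <- qE]]; exists (fun w => p w + q w).
by split=> [|//|w]; [exact: ccontD|rewrite (pE w) (qE w); ring].
Qed.

Lemma cderM f g z l m : cder f z l -> cder g z m ->
  cder (fun w => f w * g w) z (l * g z + f z * m).
Proof.
move=> fl gm; have cg := cder_continuous gm.
move: fl gm => [p [cp <- pE]] [q [cq <- qE]]; exists (fun w => p w * g w + f z * q w).
split=> [|//|w]; last by rewrite (pE w) (qE w); ring.
exact (ccontD (ccontM cp cg) (ccontM (@ccont_cst R (f z) z) cq)).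
Qed.

Lemma cderZ (k : C) f z l : cder f z l -> cder (fun w => k * f w) z (k * l).
Proof. by move=> fl; have := cderM (cder_cst k z) fl; rewrite mul0r add0r. Qed.

Lemma cderN f z l : cder f z l -> cder (fun w => - f w) z (- l).
Proof. by move=> /(cderZ (-1)); rewrite mulN1r; under eq_fun do rewrite mulN1r. Qed.

Lemma cderB f g z l m : cder f z l -> cder g z m -> cder (fun w => f w - g w) z (l - m).
Proof. by move=> fl gm; exact: cderD fl (cderN gm). Qed.

Lemma cder_comp f g z l m : cder f z l -> cder g (f z) m ->
  cder (fun w => g (f w)) z (m * l).
Proof.
move=> fl gm; have cf := cder_continuous fl.
move: fl gm => [p [cp <- pE]] [q [cq <- qE]]; exists (fun w => q (f w) * p w).
split=> [|//|w]; last by rewrite (qE (f w)) {2}(pE w); ring.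
exact (ccontM (ccont_comp cf cq) cp).
Qed.

Lemma cderV f z l : f z != 0 -> cder f z l -> cder (fun w => (f w)^-1) z (- l / f z ^+ 2).
Proof.
move=> fz0 fl; suff invz : cder (fun w => w^-1) (f z) (- (f z ^+ 2)^-1).
  by have := cder_comp fl invz; rewrite mulNr [_^-1 * _]mulrC -mulNr.
move: (f z) fz0 => y y0 {f z l fl}; have yy0 : 0 < cmod y by rewrite cmod_gt0.
(* The slope identity must hold at every [w], but at 0 the inverse has the default value 0. It is
   replaced there by the value that the slope [- y^-2] dictates; the point 0 lies at distance
   [cmod y] from [y]. *)
apply: (@cder_near (fun w => if w == 0 then y^-1 - (0 - y) * y^-1 ^+ 2 else w^-1)).
  exists (cmod y) => // w; case: eqVneq => // ->.
  by rewrite sub0r cmodN ltxx.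
exists (fun w => if w == 0 then - y^-2 else - (w * y)^-1); split.
- have H : {for y, continuous (fun w : C => - (w * y)^-1)}.
    have yy : y * y != 0 by rewrite mulf_neq0.
    exact (ccontN (@ccontV R (fun w => w * y) y yy (ccontM (@ccont_id R y)
      (@ccont_cst R y y)))).
  apply/continuousCP => e e0; have [d d0 Hd] := iffLR (continuousCP _ _) H e e0.
  exists (Num.min d (cmod y)) => [|w]; first by rewrite lt_min d0.
  rewrite lt_min (negbTE y0) => /andP[wd wy]; case: eqVneq => [w0|_]; last exact: Hd.
  by move: wy; rewrite w0 sub0r cmodN ltxx.
- by rewrite (negbTE y0) expr2.
- move=> w; rewrite (negbTE y0); case: eqVneq => [->|w0]; first by rewrite exprVn; ring.
  by field; rewrite y0 w0.
Qed.

Lemma cder_div f g z l m : g z != 0 -> cder f z l -> cder g z m ->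
  cder (fun w => f w / g w) z ((l * g z - f z * m) / g z ^+ 2).
Proof.
move=> g0 fl gm; have := cderM fl (cderV g0 gm).
by set k := (k in cder _ _ k -> _); have -> : k = (l * g z - f z * m) / g z ^+ 2
  by rewrite /k; field.
Qed.

Lemma cder_sum (n : nat) (f : 'I_n -> C -> C) (l : 'I_n -> C) z :
  (forall i, cder (f i) z (l i)) -> cder (fun w => \sum_i f i w) z (\sum_i l i).
Proof.
elim: n f l => [|n IH] f l H.
  by under eq_fun do rewrite big_ord0; rewrite big_ord0; exact: cder_cst.
under eq_fun do rewrite big_ord_recl; rewrite big_ord_recl.
by apply: cderD => //; apply: IH.
Qed.

Lemma cder_poly (p : {poly C}) z : cder (horner p) z p^`().[z].
Proof.
elim/poly_ind: p => [|p k IH].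
  rewrite deriv0 horner0; have -> : horner (0 : {poly C}) = fun=> 0.
    by apply/funext => w; rewrite horner0.
  exact: cder_cst.
have -> : horner (p * 'X + k%:P) = fun w => p.[w] * w + k.
  by apply/funext => w; rewrite !hornerE.
rewrite derivMXaddC hornerD hornerMX.
have := cderD (cderM IH (cder_id z)) (cder_cst k z).
by rewrite mulr1 addr0 addrC.
Qed.

(** Move from [z] in the direction of the conjugate of [l]. The linear part of the increment is then
    the positive real [t |l|^2], the real part of [f] does not change, and the error is at most half
    of the linear part. *)
Lemma cder_Re_eq0 f z l (d : R) : 0 < d ->
  (forall w, cmod (w - z) < d -> complex.Re (f w) = 0) -> cder f z l -> l = 0.
Proof.
move=> d0 fRe /cderP fl; apply/eqP; rewrite -cmod_eq0; apply/eqP.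
have [//|l0] := eqVneq (cmod l) 0.
have {}l0 : 0 < cmod l by rewrite lt_def l0 cmod_ge0.
have [d' d'0 Hd] := fl _ (divr_gt0 l0 (ltr0n _ 2)).
(* The step has length [Num.min d d' / 2], inside both radii. *)
pose t := Num.min d d' / (2 * cmod l); pose w := z + t%:C * (conjc l).
have t0 : 0 < t by rewrite divr_gt0 ?mulr_gt0 // lt_min d0.
have wz : w - z = t%:C * (conjc l) by rewrite /w addrAC subrr add0r.
have mw : cmod (w - z) = t * cmod l.
  by rewrite wz cmodM cmodR cmod_conj ger0_norm // ltW.
have wE : cmod (w - z) < Num.min d d'.
  rewrite mw /t; have : 0 < Num.min d d' by rewrite lt_min d0.
  by move: (Num.min d d') => x x0; rewrite invfM mulrA divfK ?gt_eqF //; lra.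
move: wE; rewrite lt_min => /andP[wd /Hd]; rewrite mw => H.
have := le_trans (normRe_le _) H.
have fz0 : complex.Re (f z) = 0 by apply: fRe; rewrite subrr cmod0.
rewrite !ReB (fRe w wd) fz0 subrr sub0r normrN wz mulrCA -sqr_cmodC -rmorphM /=.
have tl : 0 < t * cmod l ^+ 2 by apply: mulr_gt0 => //; exact: exprn_gt0.
rewrite gtr0_norm //.
have -> : cmod l / 2 * (t * cmod l) = (t * cmod l ^+ 2) / 2 by field.
by lra.
Qed.

End ComplexDerivative.

(** * Restriction to real lines and the mean value inequality *)

Section RealSlices.
Variable R : realType.
Local Notation C := R[i].
Implicit Types (f g : C -> C) (z w l m : C).

Lemma derivable_cder f z : derivable f z 1 -> cder f z (derive1 f z).
Proof.
move=> df; apply/cderP => e e0; rewrite derive1E.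
have /cvg_lim : (fun h => h^-1 *: (f (h *: 1 + z) - f z)) @ 0^' --> 'D_1 f z by exact: df.
have dfl : (fun h => h^-1 *: (f (h *: 1 + z) - f z)) @ 0^' --> 'D_1 f z by exact: df.
move=> _; set l := 'D_1 f z in dfl *.
have : nbhs l [set w | cmod (w - l) < e] by apply/nbhsCP; exists e.
move=> /dfl /nbhsCP[d d0 Hd]; exists d => // w wz.
have [->|wz0] := eqVneq w z; first by rewrite !subrr mulr0 subrr cmod0 mulr0.
have wz1 : w - z != 0 by rewrite subr_eq0.
have := Hd (w - z); rewrite subr0 => /(_ wz wz1) /=.
rewrite [_ *: 1]mulr1 subrK => /ltW H.
have -> : f w - f z - l * (w - z) = ((w - z)^-1 *: (f w - f z) - l) * (w - z).
  by rewrite mulrBl [_ *: _]mulrC divfK.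
by rewrite cmodM ler_wpM2r ?cmod_ge0.
Qed.

Lemma is_derive_RP (g : R -> R) (x l : R) :
  (forall e, 0 < e -> exists2 d : R, 0 < d &
    forall h, `|h| < d -> `|g (h + x) - g x - l * h| <= e * `|h|) ->
  is_derive x 1 g l.
Proof.
move=> H; suff Hc : (fun h => h^-1 *: (g (h *: 1 + x) - g x)) @ 0^' --> l.
  by split; [exact: cvgP Hc|exact: cvg_lim Hc].
apply/cvgrPdist_le => e /H[d d0 Hd]; near=> h.
have h0 : h != 0 by near: h; exact: nbhs_dnbhs_neq.
have hd : `|h| < d by near: h; apply: dnbhs0_lt.
have -> : l - h^-1 *: (g (h *: 1 + x) - g x) = - ((g (h + x) - g x - l * h) / h).
  by rewrite /GRing.scale /= mulr1; field.
by rewrite normrN normrM normfV ler_pdivrMr ?normr_gt0 // Hd.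
Unshelve. all: by end_near. Qed.

Lemma is_derive_line f (z w c l : C) (t : R) : cder f (z + t%:C * w) l ->
  is_derive t 1 (fun s : R => complex.Re (c * f (z + s%:C * w))) (complex.Re (c * (l * w))).
Proof.
move=> /cderP fl; apply: is_derive_RP => e e0.
have K0 : 0 < cmod c * cmod w + 1 by rewrite ltr_wpDl // mulr_ge0 ?cmod_ge0.
have [d d0 Hd] := fl _ (divr_gt0 e0 K0).
exists (d / (cmod w + 1)) => [|h]; first by rewrite divr_gt0 // ltr_wpDl ?cmod_ge0.
rewrite ltr_pdivlMr ?ltr_wpDl ?cmod_ge0 // => hd.
have hE : z + (h + t)%:C * w - (z + t%:C * w) = h%:C * w by rewrite rmorphD /=; ring.
have := Hd (z + (h + t)%:C * w); rewrite hE cmodM cmodR => H.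
have hw : `|h| * cmod w <= `|h| * (cmod w + 1) by rewrite ler_wpM2l // lerDl.
have {}H := H (le_lt_trans hw hd).
have -> : complex.Re (c * f (z + (h + t)%:C * w)) - complex.Re (c * f (z + t%:C * w))
    - complex.Re (c * (l * w)) * h =
    complex.Re (c * (f (z + (h + t)%:C * w) - f (z + t%:C * w) - l * (h%:C * w))).
  rewrite [X in _ - X]mulrC -ReZ -!ReB; congr complex.Re; ring.
apply: (le_trans (normRe_le _)); rewrite cmodM.
apply: (le_trans (ler_wpM2l (cmod_ge0 c) H)).
have -> : cmod c * (e / (cmod c * cmod w + 1) * (`|h| * cmod w)) =
  e * `|h| * (cmod c * cmod w / (cmod c * cmod w + 1)) by ring.
rewrite ler_piMr ?mulr_ge0 ?(ltW e0) //.
by rewrite ler_pdivrMr // mul1r lerDl.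
Qed.

Lemma is_derive_Re_line f (z w l : C) (t : R) : cder f (z + t%:C * w) l ->
  is_derive t 1 (fun s : R => complex.Re (f (z + s%:C * w))) (complex.Re (l * w)).
Proof.
move=> /(is_derive_line 1); rewrite mul1r; by under eq_fun do rewrite mul1r.
Qed.

Lemma is_derive_MVT (g dg : R -> R) (a b : R) : a < b ->
  (forall x, a <= x <= b -> is_derive x 1 g (dg x)) ->
  exists2 c, a < c < b & g b - g a = dg c * (b - a).
Proof.
move=> ab H; have [||c] := @MVT R g dg a b ab.
- by move=> x; rewrite in_itv /= => /andP[ax xb]; apply: H; rewrite !ltW.
- by apply: derivable_within_continuous => x; rewrite in_itv /= => /H[].
- by rewrite in_itv /= => cab E; exists c.
Qed.

(** The real mean value theorem applies to [Re (c (f - l id))] along the segment, for each unit [c],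
    and [cmod_leP] removes [c]. The term [l] makes this a bound on the linearization error, which is
    what a Riemann sum requires. *)
Lemma cder_segment_le f (df : R -> C) z w l (e : R) :
  (forall s : R, 0 <= s <= 1 -> cder f (z + s%:C * (w - z)) (df s)) ->
  (forall s : R, 0 <= s <= 1 -> cmod (df s - l) <= e) ->
  cmod (f w - f z - l * (w - z)) <= e * cmod (w - z).
Proof.
move=> fd dfl; apply: cmod_leP => c c1.
have lin u : cder (fun x => l * x) u l by rewrite -[X in cder _ _ X]mulr1; apply/cderZ/cder_id.
have gd (s : R) : 0 <= s <= 1 -> is_derive s 1
    (fun s : R => complex.Re (c * (f (z + s%:C * (w - z)) - l * (z + s%:C * (w - z)))))
    (complex.Re (c * ((df s - l) * (w - z)))).
  move=> s01; apply: (@is_derive_line (fun x => f x - l * x)).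
  by apply: cderB; [exact: fd|exact: lin].
have [s s01] := is_derive_MVT ltr01 gd.
rewrite -ReB subr0 mulr1 rmorph1 rmorph0 mul1r mul0r addr0 (addrC z) subrK => E.
have -> : complex.Re (c * (f w - f z - l * (w - z))) =
  complex.Re (c * (f w - l * w) - c * (f z - l * z)) by congr complex.Re; ring.
rewrite E; apply: (le_trans (ler_norm _)); apply: (le_trans (normRe_le _)).
rewrite !cmodM c1 mul1r ler_wpM2r ?cmod_ge0 // dfl //.
by move/andP: s01 => [? ?]; rewrite !ltW.
Qed.

Lemma cder0_segment f z w :
  (forall s : R, 0 <= s <= 1 -> cder f (z + s%:C * (w - z)) 0) -> f w = f z.
Proof.
move=> f0; have := @cder_segment_le f (fun=> 0) z w 0 0 f0.
rewrite subrr cmod0 mul0r subr0 mul0r => H.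
apply/eqP; rewrite -subr_eq0 -cmod_eq0; apply/eqP/le_anti.
by rewrite cmod_ge0 H.
Qed.

End RealSlices.

(** * A discrete Poisson formula *)

Section UnitCircle.
Variable R : realType.
Local Notation C := R[i].
Implicit Types (f g : C -> C) (z w : C).

Lemma expiD (s t : R) : expi (s + t) = expi s * expi t.
Proof. by rewrite /expi cosD sinD; apply/eqP;
  rewrite eq_complex /= eqxx addrC [_ * _ + _]addrC eqxx. Qed.

Lemma expi0 : expi 0 = 1 :> C.
Proof. by rewrite /expi cos0 sin0. Qed.

Lemma expiX (t : R) n : expi t ^+ n = expi (n%:R * t).
Proof.
elim: n => [|n IH]; first by rewrite mul0r expi0.
by rewrite exprS IH -expiD -[n.+1%:R]natr1 mulrDl mul1r addrC.
Qed.

Lemma cmod_expi (t : R) : cmod (expi t) = 1.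
Proof. by rewrite /cmod /= cos2Dsin2 sqrtr1. Qed.

Lemma expi_neq0 (t : R) : expi t != 0.
Proof. by rewrite -cmod_eq0 cmod_expi oner_eq0. Qed.

Lemma continuous_Complex (p : R * R) : {for p, continuous (fun p : R * R => Complex p.1 p.2)}.
Proof.
move=> A /nbhsCP[d d0 HA].
have d2 : 0 < d / 2 by rewrite divr_gt0.
exists (ball p.1 (d / 2), ball p.2 (d / 2)); first by split; exact: nbhsx_ballx.
move=> [x y] [/= hx hy]; apply: HA; apply: (le_lt_trans (cmod_le_ReIm _)) => /=.
move: hx hy; rewrite /ball /= distrC => hx; rewrite distrC => hy.
by rewrite [d]splitr ltrD.
Qed.

Lemma expi_cvg (t : R) (e : R) : 0 < e ->
  exists2 d : R, 0 < d & forall s, `|s - t| < d -> cmod (expi s - expi t) < e.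
Proof.
move=> e0; have e2 : 0 < e / 2 by rewrite divr_gt0.
have Hc : \forall s \near t, `|cos t - cos s| < e / 2.
  by have /cvgrPdist_lt := @continuous_cos R t; apply.
have Hs : \forall s \near t, `|sin t - sin s| < e / 2.
  by have /cvgrPdist_lt := @continuous_sin R t; apply.
have [d d0 Hd] := iffLR (nbhs_ballP _ _) (filterI Hc Hs); exists d => // s st.
have [] := Hd s; first by rewrite /ball /= distrC.
move=> h1 h2; apply: (le_lt_trans (cmod_le_ReIm _)) => /=.
by rewrite distrC [X in _ + X]distrC [e]splitr ltrD.
Qed.

(** Compactness of the real square that contains the disk. At points of modulus below [r] continuity
    applies; at the other points of the square [Q] is vacuous on a whole neighbourhood, which stays
    outside the closed unit disk. *)
Lemma uniform_continuous_disk (G : C -> C) (r e : R) : 1 < r -> 0 < e ->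
  (forall z, cmod z < r -> {for z, continuous G}) ->
  exists2 d : R, 0 < d &
    forall z w, cmod z <= 1 -> cmod (w - z) < d -> cmod (G w - G z) < e.
Proof.
move=> r1 e0 cG.
pose cplx := fun p : R * R => Complex p.1 p.2.
pose sq : set (R * R) := `[-1, 1]%classic `*` `[-1, 1]%classic.
have /compact_near_coveringP csq : compact sq by apply: compact_setX; exact: segment_compact.
have cnear p (d : R) : 0 < d -> nbhs p (cplx @^-1` [set w | cmod (w - cplx p) < d]).
  by move=> d0; apply: continuous_Complex; apply/nbhsCP; exists d.
pose Q (d : R) p := cmod (cplx p) <= 1 ->
  forall w, cmod (w - cplx p) < d -> cmod (G w - G (cplx p)) < e.
have FF : Filter (0 : R)^'+ by exact: at_right_proper_filter.
have : \forall d \near (0 : R)^'+, sq `<=` Q d.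
  apply: (csq R (0 : R)^'+ Q FF) => p _.
  have [pr|rp] := ltP (cmod (cplx p)) r.
    have e2 : 0 < e / 2 by rewrite divr_gt0.
    have [d d0 Hd] := iffLR (continuousCP _ _) (cG _ pr) _ e2.
    have d2 : 0 < d / 2 by rewrite divr_gt0.
    exists (cplx @^-1` [set w | cmod (w - cplx p) < d / 2], [set x | x < d / 2]).
      by split=> /=; [exact: cnear|exact: nbhs_right_lt].
    move=> [q x] [/= qp xd] _ w wq.
    have hq : cmod (G (cplx q) - G (cplx p)) < e / 2 by apply: Hd; lra.
    have hw : cmod (G w - G (cplx p)) < e / 2.
      apply: Hd; rewrite -(subrKA (cplx q)); apply: (le_lt_trans (cmodD _ _)); lra.
    rewrite -(subrKA (G (cplx p))); apply: (le_lt_trans (cmodD _ _)).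
    by rewrite (cmodB (G (cplx p))); lra.
  have d0 : 0 < cmod (cplx p) - 1 by rewrite subr_gt0 (lt_le_trans r1).
  exists (cplx @^-1` [set w | cmod (w - cplx p) < cmod (cplx p) - 1], setT).
    by split=> /=; [exact: cnear|exact: filterT].
  move=> [q x] [/= qp _] q1.
  have := cmodD (cplx q) (cplx p - cplx q); rewrite [cplx q + _]addrC subrK.
  by rewrite cmodB; lra.
move=> H; have [d [d0 Hd]] : exists d : R, 0 < d /\ sq `<=` Q d.
  apply: (@filter_ex _ (0 : R)^'+); apply: filterI => //; exact: nbhs_right_gt.
exists d => // z w z1; have zsq : sq (complex.Re z, complex.Im z).
  have := le_trans (normRe_le z) z1; have := le_trans (normIm_le z) z1.
  by rewrite !ler_norml => /andP[? ?] /andP[? ?]; split; rewrite /= in_itv /=;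
    apply/andP; split; lra.
have := Hd _ zsq; rewrite /Q /cplx /= -[X in cmod X <= _]/(_ +i* _).
have -> : complex.Re z +i* complex.Im z = z by case: z {z1 zsq}.
by move=> H'; exact: H'.
Qed.

Definition root_of_unity (N : nat) : C := expi (2 * pi / N%:R).

Lemma root_of_unityX N : (0 < N)%N -> root_of_unity N ^+ N = 1.
Proof.
move=> N0; rewrite expiX mulrCA divff ?pnatr_eq0 -?lt0n // mulr1.
by rewrite mulr_natl /expi cos2pi sin2pi.
Qed.

Lemma cmod_root_of_unityX N k : cmod (root_of_unity N ^+ k) = 1.
Proof. by rewrite cmodX cmod_expi expr1n. Qed.

Lemma root_of_unity_cvg (e : R) : 0 < e ->
  exists N0 : nat, forall N, (N0 <= N)%N -> cmod (root_of_unity N - 1) < e.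
Proof.
move=> e0; have [d d0 Hd] := expi_cvg 0 e0.
exists (Num.truncn (2 * pi / d)).+1 => N HN; rewrite -expi0; apply: Hd.
have N0 : 0 < N%:R :> R by rewrite ltr0n (leq_trans _ HN).
have tp : 0 < 2 * pi :> R by rewrite mulr_gt0 // pi_gt0.
rewrite subr0 gtr0_norm ?divr_gt0 // ltr_pdivrMr // [X in _ < X]mulrC -ltr_pdivrMr //.
have NN : (Num.truncn (2 * pi / d)).+1%:R <= N%:R :> R by rewrite ler_nat.
by apply: lt_le_trans NN; exact: truncnS_gt.
Qed.

Lemma root_of_unity_neq1 N : (2 < N)%N -> root_of_unity N != 1.
Proof.
move=> N2; have N0 : 0 < N%:R :> R by rewrite ltr0n (leq_trans _ N2).
have : 0 < sin (2 * pi / N%:R :> R).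
  apply: sin_gt0_pi; rewrite divr_gt0 ?mulr_gt0 ?pi_gt0 //= ltr_pdivrMr //.
  by rewrite [X in _ < X]mulrC ltr_pM2r ?pi_gt0 // (ltr_nat R 2).
by move=> s0; apply/eqP => -[_ sE]; rewrite sE ltxx in s0.
Qed.

End UnitCircle.

Section DiscretePoisson.
Variable R : realType.
Local Notation C := R[i].
Local Notation om := (root_of_unity R).
Implicit Types (F : C -> C) (z w e : C).

Lemma cmod_segment (z w : C) (r s : R) : cmod z <= r -> cmod w <= r -> 0 <= s <= 1 ->
  cmod (z + s%:C * (w - z)) <= r.
Proof.
move=> zr wr /andP[s0 s1].
have -> : z + s%:C * (w - z) = (1 - s)%:C * z + s%:C * w.
  by rewrite rmorphB rmorph1; ring.
apply: (le_trans (cmodD _ _)); rewrite !cmodM !cmodR !ger0_norm ?subr_ge0 //; nra.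
Qed.

(** The continuity of the derivative is recorded rather than deduced; for the roof function it comes
    from the continuous partial derivatives of [u] ([roof_holo]). *)
Definition holo_disk (r : R) F dF := forall z, cmod z < r ->
  cder F z (dF z) /\ {for z, continuous dF}.

Section Riemann.
Variables (r : R) (F dF : C -> C).
Hypotheses (r1 : 1 < r) (FdF : holo_disk r F dF).

(* The sum is, up to [(w - 1) s], a Riemann sum for the derivative of the
   periodic function [t |-> F (z + s (expi t - z))], hence nearly telescopes. *)
Lemma telescoping_sum_small (e : R) : 0 < e -> exists N0, forall N, (N0 <= N)%N ->
  forall z (s : R), cmod z <= 1 -> 0 <= s <= 1 ->
  cmod (\sum_(k < N) dF (z + s%:C * (om N ^+ k - z)) * om N ^+ k) <= N%:R * e.
Proof.
move=> e0; have [d d0 Hd] := uniform_continuous_disk r1 e0 (fun z zr => (FdF zr).2).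
have [N1 HN1] := root_of_unity_cvg d0.
exists (maxn N1 3) => N; rewrite geq_max => /andP[N1N N3] z s z1 s01; set w := om N.
have w1 : w != 1 by exact: root_of_unity_neq1.
have wN : w ^+ N = 1 by apply: root_of_unityX; rewrite (leq_trans _ N3).
have /andP[s0 s1] := s01.
(* The division by [s * cmod (w - 1)] below excludes the constant loop; for it the sum is a multiple
   of the sum of all roots of unity, which is 0. *)
have [->|sn0] := eqVneq s 0.
  under eq_bigr do rewrite rmorph0 mul0r addr0.
  rewrite -mulr_sumr.
  have /eqP : (w - 1) * \sum_(i < N) w ^+ i = 0 by rewrite -subrX1 wN subrr.
  rewrite mulf_eq0 subr_eq0 (negbTE w1) /= => /eqP ->.
  by rewrite mulr0 cmod0 mulr_ge0 // ltW.
pose y k := z + s%:C * (w ^+ k - z).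
have y1 k : cmod (y k) <= 1 by apply: cmod_segment => //; rewrite cmod_root_of_unityX.
have yS k : y k.+1 - y k = s%:C * (w - 1) * w ^+ k by rewrite /y exprS; ring.
have cyS k : cmod (y k.+1 - y k) = s * cmod (w - 1).
  by rewrite yS !cmodM cmod_root_of_unityX mulr1 cmodR ger0_norm.
have D k : cmod (F (y k.+1) - F (y k) - dF (y k) * (y k.+1 - y k)) <= e * (s * cmod (w - 1)).
  rewrite -(cyS k); apply: (@cder_segment_le _ F (fun t => dF (y k + t%:C * (y k.+1 - y k)))).
    move=> t t01; apply: (FdF _).1; apply: le_lt_trans r1; exact: cmod_segment.
  move=> t /andP[t0 t1]; apply/ltW/Hd => //.
  rewrite addrAC subrr add0r cmodM cyS cmodR ger0_norm //.
  have := HN1 N N1N; have := cmod_ge0 (w - 1); rewrite -/w => h0 h1.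
  have ts : t * s <= 1 by rewrite mulr_ile1.
  have : t * s * cmod (w - 1) <= 1 * cmod (w - 1) by rewrite ler_wpM2r.
  by rewrite mul1r mulrA => h2; apply: le_lt_trans h1.
have tel : \sum_(k < N) (F (y k.+1) - F (y k)) = 0.
  rewrite -(big_mkord xpredT (fun k => F (y k.+1) - F (y k))) telescope_sumr //.
  by rewrite /y wN expr0 subrr.
have K0 : 0 < s * cmod (w - 1).
  by rewrite mulr_gt0 ?cmod_gt0 ?subr_eq0 // lt_def sn0.
rewrite -(ler_pM2l K0).
have -> : s * cmod (w - 1) * cmod (\sum_(k < N) dF (y k) * w ^+ k) =
    cmod (\sum_(k < N) (F (y k.+1) - F (y k) - dF (y k) * (y k.+1 - y k))).
  rewrite sumrB tel sub0r cmodN.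
  under [in RHS]eq_bigr do rewrite yS mulrCA.
  by rewrite -mulr_sumr !cmodM cmodR ger0_norm.
apply: (le_trans (cmod_sum _ _ _));
  apply: (@le_trans _ _ (\sum_(k < N) e * (s * cmod (w - 1)))).
  by apply: ler_sum => k _; exact: D.
rewrite sumr_const card_ord -[_ *+ N]mulr_natl le_eqVlt; apply/orP; left; apply/eqP; ring.
Qed.

(* Homotopy from the circle to [z]: the sum at the intermediate loop
   [z + s (w^k - z)] has the sum bounded above as derivative in [s]. *)
Lemma discrete_cauchy z (e : R) : cmod z < 1 -> 0 < e -> exists N0, forall N, (N0 <= N)%N ->
  cmod (\sum_(k < N) F (om N ^+ k) * (om N ^+ k / (om N ^+ k - z)) -
        F z * \sum_(k < N) om N ^+ k / (om N ^+ k - z)) <= N%:R * e.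
Proof.
move=> z1 e0; have [N0 HN0] := telescoping_sum_small e0.
exists N0 => N /HN0; set w := om N => H; have wz k : w ^+ k - z != 0.
  rewrite subr_eq0; apply/eqP => wz; move: z1.
  by rewrite -wz cmod_root_of_unityX ltxx.
pose f (s : C) := \sum_(k < N) F (z + s * (w ^+ k - z)) * (w ^+ k / (w ^+ k - z)).
pose df (s : R) := \sum_(k < N) dF (z + s%:C * (w ^+ k - z)) * w ^+ k.
have := @cder_segment_le _ f df 0 1 0 (N%:R * e).
rewrite mul0r !subr0 cmod1 mulr1.
have -> : f 1 = \sum_(k < N) F (w ^+ k) * (w ^+ k / (w ^+ k - z)).
  by apply: eq_bigr => k _; rewrite mul1r addrC subrK.
have -> : f 0 = F z * \sum_(k < N) w ^+ k / (w ^+ k - z).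
  by rewrite mulr_sumr; apply: eq_bigr => k _; rewrite mul0r addr0.
apply=> s s01; last by rewrite subr0; apply: H => //; exact: ltW.
rewrite add0r mulr1; apply: cder_sum => k.
have -> : dF (z + s%:C * (w ^+ k - z)) * w ^+ k =
    dF (z + s%:C * (w ^+ k - z)) * (w ^+ k - z) * (w ^+ k / (w ^+ k - z)) +
    F (z + s%:C * (w ^+ k - z)) * 0 by field.
apply: cderM; last exact: cder_cst.
apply: (@cder_comp _ (fun x => z + x * (w ^+ k - z)) F).
  have := cderD (cder_cst z s%:C) (cderM (cder_id s%:C) (cder_cst (w ^+ k - z) s%:C)).
  by rewrite mulr0 addr0 mul1r add0r.
apply: (FdF _).1; apply: le_lt_trans r1; apply: cmod_segment => //; first exact: ltW.
by rewrite cmod_root_of_unityX.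
Qed.

Lemma discrete_mean (e : R) : 0 < e -> exists N0, forall N, (N0 <= N)%N ->
  cmod (\sum_(k < N) F (om N ^+ k) - N%:R * F 0) <= N%:R * e.
Proof.
move=> e0; have c0 : cmod (0 : C) < 1 by rewrite cmod0.
have [N0 H] := discrete_cauchy c0 e0.
exists N0 => N /H /=; set w := om N.
have w1 k : w ^+ k / (w ^+ k - 0) = 1 by rewrite subr0 divff // expf_neq0 // expi_neq0.
under eq_bigr do rewrite w1 mulr1; under [in X in _ - X]eq_bigr do rewrite w1.
by rewrite sumr_const card_ord mulrC.
Qed.

End Riemann.

Definition poisson_kernel z e : R := complex.Re ((e + z) / (e - z)).

(** With W = w/(w-z) the kernel is W + conj W - 1. The term W is handled by [discrete_cauchy]. On
    the circle conj W equals K(w) = 1/(1 - conj z w), which is holomorphic beyond the closed disk,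
    so F (K - 1) averages to its value at 0, that is 0. The mean of K itself, which is 1, normalizes
    the sum of the W. *)
Lemma discrete_poissonC (r : R) F dF z (e : R) : 1 < r -> holo_disk r F dF -> cmod z < 1 ->
  0 < e ->
  exists N0, forall N, (N0 <= N)%N ->
  cmod (\sum_(k < N) (poisson_kernel z (om N ^+ k))%:C * F (om N ^+ k) - N%:R * F z) <=
    N%:R * e.
Proof.
move=> r1 FdF z1 e0.
pose K (y : C) : C := (1 - (conjc z) * y)^-1; pose dK (y : C) : C := (conjc z) * (K y * K y).
(* The second bound lies strictly between 1 and [1 / cmod z], so [K] has no pole in the disk of
   radius [r']. *)
pose r' := Num.min r (2 / (1 + cmod z)).
have z0 := cmod_ge0 z; have c1 : 0 < 1 + cmod z by lra.
have r'1 : 1 < r' by rewrite lt_min r1 ltr_pdivlMr //; lra.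
have Kne y : cmod y < r' -> 1 - (conjc z) * y != 0.
  move=> yr; rewrite subr_eq0; apply/eqP => E.
  have : cmod z * cmod y < 1.
    move: yr; rewrite lt_min => /andP[_]; rewrite ltr_pdivlMr //.
    by have := cmod_ge0 y; nra.
  by rewrite -(cmod_conj z) -cmodM -E cmod1 ltxx.
have KdK : holo_disk r' K dK.
  move=> y yr; have Ky : cder K y (dK y).
    have lin : cder (fun y => 1 - (conjc z) * y) y (0 - (conjc z) * 1).
      exact (cderB (cder_cst 1 y) (cderZ (conjc z) (cder_id y))).
    have := @cderV _ (fun y => 1 - (conjc z) * y) y _ (Kne y yr) lin.
    by rewrite sub0r mulr1 opprK /dK /K -invfM expr2.
  split=> //; have cK := cder_continuous Ky.
  exact (ccontM (@ccont_cst R (conjc z) y) (ccontM cK cK)).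
pose G y := F y * (K y - 1); pose dG y := dF y * (K y - 1) + F y * dK y.
have GdG : holo_disk r' G dG.
  move=> y yr; have [Ky cdK] := KdK y yr.
  have [Fy cdF] : cder F y (dF y) /\ {for y, continuous dF}.
    by apply: FdF; move: yr; rewrite lt_min => /andP[].
  have K1 : cder (fun y => K y - 1) y (dK y).
    by have := cderB Ky (cder_cst 1 y); rewrite subr0.
  split; first exact: cderM.
  exact (ccontD (ccontM cdF (cder_continuous K1)) (ccontM (cder_continuous Fy) cdK)).
have e4 : 0 < e / 4 by rewrite divr_gt0.
have F1 : 0 < cmod (F z) + 1 by rewrite ltr_wpDl ?cmod_ge0.
have [N1 H1] := discrete_cauchy r1 FdF z1 e4.
have [N2 H2] := discrete_mean r'1 KdK (divr_gt0 e4 F1).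
have [N3 H3] := discrete_mean r'1 GdG e4.
exists (maxn N1 (maxn N2 N3)) => N; rewrite !geq_max => /and3P[/H1 /= h1 /H2 h2 /H3 h3].
set w := om N in h1 h2 h3 *.
have Kw k : w ^+ k / (w ^+ k - z) = conjc (K (w ^+ k)).
  have wJ : w ^+ k * conjc (w ^+ k) = 1 by rewrite -sqr_cmodC cmod_root_of_unityX expr1n.
  have w0 : w ^+ k != 0 by rewrite expf_neq0 // expi_neq0.
  have -> : w ^+ k - z = w ^+ k * (1 - z * conjc (w ^+ k))
    by rewrite mulrBr mulr1 mulrCA wJ mulr1.
  by rewrite /K conjc_inv rmorphB rmorphM rmorph1 /= conjcK invfM mulrA divff ?mul1r.
have wz k : w ^+ k - z != 0.
  by rewrite subr_eq0; apply/eqP => wz; move: z1; rewrite -wz cmod_root_of_unityX ltxx.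
have PE k : (poisson_kernel z (w ^+ k))%:C * F (w ^+ k) =
    F (w ^+ k) * (w ^+ k / (w ^+ k - z)) + G (w ^+ k).
  have -> : G (w ^+ k) = F (w ^+ k) * (conjc (w ^+ k / (w ^+ k - z)) - 1) by rewrite Kw conjcK.
  rewrite /poisson_kernel ReJ_add.
  have -> : (w ^+ k + z) / (w ^+ k - z) = 2 * (w ^+ k / (w ^+ k - z)) - 1 by field.
  rewrite rmorphB rmorphM rmorph_nat rmorph1 /=.
  by move: (w ^+ k / _) (conjc _) => A B; field.
under eq_bigr do rewrite PE.
rewrite big_split /=.
have K0 : K 0 = 1 by rewrite /K mulr0 subr0 invr1.
have G0 : G 0 = 0 by rewrite /G K0 subrr mulr0.
rewrite G0 mulr0 subr0 in h3; rewrite K0 mulr1 in h2.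
have {}h2 : cmod (\sum_(k < N) w ^+ k / (w ^+ k - z) - N%:R) <=
  N%:R * (e / 4 / (cmod (F z) + 1)).
  rewrite -cmod_conj rmorphB rmorph_nat rmorph_sum /=.
  by under eq_bigr do rewrite Kw conjcK.
set S1 := \sum_(k < N) _ * _ in h1 *; set S2 := \sum_(k < N) _ / _ in h1 h2.
set S3 := \sum_(k < N) _ in h3 *.
have -> : S1 + S3 - N%:R * F z = S1 - F z * S2 + F z * (S2 - N%:R) + S3 by ring.
apply: (le_trans (cmodD _ _)); apply: (le_trans (lerD (cmodD _ _) (lexx _))).
have h4 : cmod (F z * (S2 - N%:R)) <= N%:R * (e / 4).
  rewrite cmodM; apply: (le_trans (ler_wpM2l (cmod_ge0 _) h2)).
  rewrite mulrCA ler_wpM2l // mulrA ler_pdivrMr // [X in _ <= X]mulrC.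
  by rewrite ler_wpM2r ?(ltW e4) // lerDl.
have N0 : 0 <= N%:R :> R by [].
by nra.
Qed.

Lemma discrete_poisson (r : R) F dF z (e : R) : 1 < r -> holo_disk r F dF -> cmod z < 1 ->
  0 < e ->
  exists N0, forall N, (N0 <= N)%N ->
  `|\sum_(k < N) poisson_kernel z (om N ^+ k) * complex.Re (F (om N ^+ k)) -
    N%:R * complex.Re (F z)| <= N%:R * e.
Proof.
move=> r1 FdF z1 e0; have [N0 H] := discrete_poissonC r1 FdF z1 e0.
exists N0 => N /H; apply: le_trans; apply: le_trans (normRe_le _).
rewrite ReB Re_sum -[N%:R in X in _ <= X](rmorph_nat (real_complex R)) ReZ.
by under [in X in _ <= X]eq_bigr do rewrite ReZ.
Qed.

End DiscretePoisson.

(** * Positive harmonic functions on the disk *)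

Section PositiveHarmonic.
Variable R : realType.
Local Notation C := R[i].
Implicit Types (z w e : C).

Lemma poisson_kernelE z e : cmod e = 1 -> e != z ->
  poisson_kernel z e = (1 - cmod z ^+ 2) / cmod (e - z) ^+ 2.
Proof.
move=> e1 ez; have ez0 : e - z != 0 by rewrite subr_eq0.
have cz0 : cmod (e - z) != 0 by rewrite cmod_eq0.
rewrite /poisson_kernel; have -> : (e +
  z) / (e - z) = (((cmod (e - z)) ^+ 2)^-1)%:C * ((e + z) * conjc (e - z)).
  have : conjc (e - z) != 0 by rewrite conjc_eq0.
  have -> : (((cmod (e - z)) ^+ 2)^-1)%:C = ((e - z) * conjc (e - z))^-1.
    by rewrite -sqr_cmodC fmorphV.
  move: (conjc (e - z)) => y y0; field.
  by rewrite y0 ez0.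
rewrite ReZ mulrC; congr (_ / _).
have -> : (e + z) * conjc (e - z) = (cmod e ^+ 2)%:C - (cmod z ^+ 2)%:C +
  (z * conjc e - e * conjc z).
  by rewrite !sqr_cmodC conjcB; ring.
rewrite e1 expr1n !ReD ReN /=; case: e z {e1 ez ez0 cz0} => a b [c d] /=; ring.
Qed.

Lemma poisson_kernel_circle z e : cmod z = 1 -> cmod e = 1 -> e != z -> poisson_kernel z e = 0.
Proof. by move=> z1 e1 ez; rewrite poisson_kernelE // z1 expr1n subrr mul0r. Qed.

(** The kernel at re times (1+r)/(1-r) is (1+r)^2 / |w - re|^2. It increases with r: after
    cross-multiplication the difference is 2 (1+x)(s-r)(1-rs), with x the cosine of the angle
    between [w] and [e]. The denominators 1-r and 1-s are cleared in the statement. *)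
Lemma poisson_kernel_monotone (w e : C) (r s : R) : cmod w = 1 -> cmod e = 1 ->
  0 <= r -> r <= s -> s < 1 ->
  poisson_kernel (r%:C * e) w * ((1 + r) * (1 - s)) <= poisson_kernel (s%:C * e) w * ((1 +
    s) * (1 - r)).
Proof.
move=> w1 e1 r0 rs s1; have r1 := le_lt_trans rs s1; have s0 := le_trans r0 rs.
have ct t : 0 <= t -> cmod (t%:C * e) = t by move=> t0; rewrite cmodM e1 mulr1 cmodR ger0_norm.
have wt t : 0 <= t -> t < 1 -> w != t%:C * e.
  by move=> t0 t1; apply/eqP => E; move: w1; rewrite E ct // => E'; rewrite E' ltxx in t1.
rewrite !poisson_kernelE ?wt // !ct //.
pose x := complex.Re (w * conjc e).
have dE t : cmod (w - t%:C * e) ^+ 2 = 1 + t ^+ 2 - 2 * t * x.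
  apply: complexI; rewrite sqr_cmodC conjcB conjcM conjc_real.
  have -> : (w - t%:C * e) * (conjc w - t%:C * conjc e) =
    w * conjc w + t%:C ^+ 2 * (e * conjc e) - t%:C * (w * conjc e + conjc (w * conjc e)).
    by rewrite conjcM conjcK; ring.
  rewrite -!sqr_cmodC w1 e1 !expr1n rmorph1 mulr1 addcJ -/x.
  by rewrite !(rmorphB, rmorphD, rmorphM, rmorphXn, rmorph1, rmorph_nat) /=; ring.
have x1 : -1 <= x.
  have := normRe_le (w * conjc e); rewrite cmodM cmod_conj w1 e1 mulr1 ler_norml.
  by case/andP.
have d0 t : 0 <= t -> t < 1 -> 0 < 1 + t ^+ 2 - 2 * t * x.
  by move=> t0 t1; rewrite -dE exprn_gt0 // cmod_gt0 subr_eq0 wt.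
rewrite !dE; have A0 := d0 _ r0 r1; have B0 := d0 _ s0 s1.
have K0 : 0 <= (1 - r) * (1 - s) by rewrite mulr_ge0 // subr_ge0 ltW.
set A := 1 + r ^+ 2 - _ in A0 *; set B := 1 + s ^+ 2 - _ in B0 *.
have -> : (1 - r ^+ 2) / A * ((1 + r) * (1 - s)) = (1 - r) * (1 - s) * ((1 +
  r) ^+ 2 / A) by field; rewrite gt_eqF.
have -> : (1 - s ^+ 2) / B * ((1 + s) * (1 - r)) = (1 - r) * (1 - s) * ((1 +
  s) ^+ 2 / B) by field; rewrite gt_eqF.
apply: ler_wpM2l => //; rewrite ler_pdivrMr // mulrAC ler_pdivlMr // -subr_ge0.
have -> : (1 + s) ^+ 2 * A - (1 + r) ^+ 2 * B = 2 * (1 + x) * (s - r) * (1 - r * s)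
  by rewrite /A /B; ring.
have rs1 : r * s <= 1 by rewrite mulr_ile1 // ltW.
by rewrite !mulr_ge0 // ?subr_ge0 //; lra.
Qed.

Variables (F dF : C -> C).
Hypotheses (FdF : holo_disk 1 F dF) (F0 : forall z, cmod z < 1 -> 0 <= complex.Re (F z)).

(** The dilation F(rho z) is holomorphic in the disk of radius [rho^-1], which exceeds 1 as
    [discrete_poisson] demands, whereas [F] is only given in the open unit disk. *)
Lemma scaled_poisson (rho : R) z (e : R) : 0 < rho < 1 -> cmod z < 1 -> 0 < e ->
  exists N0, forall N, (N0 <= N)%N ->
  `|\sum_(k < N) poisson_kernel z (root_of_unity R N ^+ k) *
      complex.Re (F (rho%:C * root_of_unity R N ^+ k)) -
    N%:R * complex.Re (F (rho%:C * z))| <= N%:R * e.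
Proof.
move=> /andP[rho0 rho1] z1 e0.
apply: (@discrete_poisson R rho^-1 (fun y => F (rho%:C * y)) (fun y => dF
  (rho%:C * y) * rho%:C)) => //.
  by rewrite invf_gt1.
move=> y yr; have ry : cmod (rho%:C * y) < 1.
  by rewrite cmodM cmodR gtr0_norm // mulrC -ltr_pdivlMr // mul1r.
have lin : cder (fun y : C => rho%:C * y) y rho%:C by rewrite -[X in cder _ _ X]mulr1;
  exact (cderZ _ (cder_id y)).
have [Fy cdF] := FdF ry; split; first exact: (cder_comp lin Fy).
exact (ccontM (ccont_comp (cder_continuous lin) cdF) (@ccont_cst R rho%:C y)).
Qed.

Lemma continuous_ReF z (e : R) : cmod z < 1 -> 0 < e -> exists2 d : R, 0 < d &
  forall w, cmod (w - z) < d -> `|complex.Re (F w) - complex.Re (F z)| < e.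
Proof.
move=> z1 e0; have [d d0 Hd] := iffLR (continuousCP _ _) (cder_continuous (FdF z1).1) e e0.
by exists d => // w /Hd; apply: le_lt_trans; rewrite -ReB; exact: normRe_le.
Qed.

Lemma radial_cvg z (e : R) : cmod z < 1 -> 0 < e ->
  exists2 rho1 : R, rho1 < 1 & forall rho, rho1 < rho < 1 ->
    `|complex.Re (F (rho%:C * z)) - complex.Re (F z)| < e.
Proof.
move=> z1 /(continuous_ReF z1)[d d0 Hd]; exists (1 - d) => [|rho /andP[r1 r2]]; first by lra.
apply: Hd; have -> : rho%:C * z - z = (rho - 1)%:C * z by rewrite rmorphB rmorph1; ring.
rewrite cmodM cmodR ltr0_norm ?subr_lt0 //; have := cmod_ge0 z; nra.
Qed.

(** The inequality holds for each kernel by [poisson_kernel_monotone], hence for the Poisson sums of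
    the dilation, whose weights are nonnegative; then rho tends to 1. *)
Lemma harnack_monotone e (r s : R) : cmod e = 1 -> 0 <= r -> r <= s -> s < 1 ->
  complex.Re (F (r%:C * e)) * ((1 + r) * (1 - s)) <= complex.Re (F (s%:C * e)) * ((1 +
    s) * (1 - r)).
Proof.
move=> e1 r0 rs s1; have r1 := le_lt_trans rs s1; have s0 := le_trans r0 rs.
have ct t : 0 <= t -> cmod (t%:C * e) = t by move=> t0; rewrite cmodM e1 mulr1 cmodR ger0_norm.
have cr1 : cmod (r%:C * e) < 1 by rewrite ct.
have cs1 : cmod (s%:C * e) < 1 by rewrite ct.
pose a := (1 + r) * (1 - s); pose b := (1 + s) * (1 - r); rewrite -/a -/b.
have a0 : 0 <= a by rewrite mulr_ge0; lra.
have b0 : 0 <= b by rewrite mulr_ge0; lra.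
have a2 : a <= 2 by rewrite /a; nra.
have b2 : b <= 2 by rewrite /b; nra.
have H rho : 0 < rho < 1 -> complex.Re (F (rho%:C * (r%:C * e))) * a <=
  complex.Re (F (rho%:C * (s%:C * e))) * b.
  move=> rho01; apply/ler_addgt0Pr => d d0; have d4 : 0 < d / 4 by rewrite divr_gt0.
  have [N1 H1] := scaled_poisson rho01 cr1 d4; have [N2 H2] := scaled_poisson rho01 cs1 d4.
  pose N := (maxn N1 N2).+1.
  have := H1 N (leq_trans (leq_maxl _ _) (leqnSn _)).
  have := H2 N (leq_trans (leq_maxr _ _) (leqnSn _)).
  set S2 := \sum_(k < N) _ => h2; set S1 := \sum_(k < N) _ => h1.
  have S12 : S1 * a <= S2 * b.
    rewrite !mulr_suml; apply: ler_sum => k _; rewrite mulrAC [X in _ <= X]mulrAC.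
    apply: ler_wpM2r; last by apply: poisson_kernel_monotone => //; exact: cmod_root_of_unityX.
    apply: F0; rewrite cmodM cmod_root_of_unityX mulr1 cmodR.
    by case/andP: rho01 => ? ?; rewrite gtr0_norm.
  have N0 : 0 < N%:R :> R by rewrite ltr0n.
  move: h1 h2; rewrite !ler_norml => /andP[h1 _] /andP[_ h2].
  rewrite -(ler_pM2l N0).
  set u1 := complex.Re _ in h1 *; set u2 := complex.Re _ in h2 *.
  have {}h1 : N%:R * u1 * a <= (S1 + N%:R * (d / 4)) * a by apply: ler_wpM2r => //; lra.
  have {}h2 : S2 * b <= (N%:R * u2 + N%:R * (d / 4)) * b by apply: ler_wpM2r => //; lra.
  have Nd : 0 <= N%:R * (d / 4) by rewrite mulr_ge0 // ltW.
  have Nda : N%:R * (d / 4) * a <= N%:R * (d / 4) * 2 by apply: ler_wpM2l.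
  have Ndb : N%:R * (d / 4) * b <= N%:R * (d / 4) * 2 by apply: ler_wpM2l.
  rewrite mulrDr mulrA [X in _ + X](_ : _ = N%:R * (d / 4) * 4); last by field.
  move: Nd Nda Ndb h1 h2; rewrite !mulrDl; lra.
apply/ler_addgt0Pr => d d0; have d4 : 0 < d / 4 by rewrite divr_gt0.
have [p p1 Hp] := radial_cvg cr1 d4; have [q q1 Hq] := radial_cvg cs1 d4.
(* [rho] is the midpoint between 1 and all the thresholds; the 0 keeps it positive. *)
pose m := Num.max 0 (Num.max p q); pose rho := (m + 1) / 2.
have m1 : m < 1 by rewrite !gt_max ltr01 p1 q1.
have [m0 mp mq] : [/\ 0 <= m, p <= m & q <= m] by rewrite /m !le_max !lexx !orbT.
have := H rho; have := Hp rho; have := Hq rho.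
have [? ? ?] : [/\ 0 < rho < 1, p < rho < 1 & q < rho < 1] by rewrite /rho; split;
  apply/andP; split; lra.
move=> /(_ ltac:(done)) h1 /(_ ltac:(done)) h2 /(_ ltac:(done)) h3.
move: h1 h2 h3; rewrite !ltr_norml => /andP[h1 h1'] /andP[h2 h2'] h3; nra.
Qed.

End PositiveHarmonic.

(** * From radial boundary limits to a bound on the whole radius *)

Section Boundary.
Variable R : realType.
Local Notation C := R[i].
Implicit Types (z w e : C).

(** A null set contains no interval of positive length. The hypotheses on almost every boundary
    point are exploited through this density, combined with continuity in [circle_density]. *)
Lemma ae_circle_dense (P : R -> Prop) : ae_circle P ->
  forall t e : R, 0 < e -> exists2 s, `|s - t| < e & P s.
Proof.
move=> [A [mA A0 PA]] t e e0; apply: contrapT => nP.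
have sub : `]t - e, t + e[%classic `<=` A.
  move=> s /=; rewrite in_itv /= => /andP[s1 s2]; apply: PA => /= Ps; apply: nP.
  by exists s => //; rewrite ltr_norml; apply/andP; split; lra.
have : (lebesgue_measure (`](t - e)%R,
  (t + e)%R[%classic : set R) <= lebesgue_measure A :> \bar R)%E.
  by apply: le_measure => //; rewrite inE //; exact: measurable_itv.
rewrite A0 lebesgue_measure_itv /= lte_fin.
have -> : (t - e < t + e)%R by lra.
by rewrite -EFinB lee_fin; lra.
Qed.

Lemma at_left1P (f : R -> R) (l : R) : f x @[x --> at_left 1] --> l ->
  forall e : R, 0 < e -> exists2 d : R, 0 < d & forall r, 1 - d < r < 1 -> `|f r - l| < e.
Proof.
move=> fl e e0; have /cvgrPdist_lt/(_ _ e0) := fl.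
move=> [d /= d0 Hd]; exists d => // r /andP[r1 r2]; rewrite distrC; apply: Hd => //=.
by rewrite gtr0_norm; lra.
Qed.

Variables (F dF : C -> C).
Hypotheses (FdF : holo_disk 1 F dF) (F0 : forall z, cmod z < 1 -> 0 <= complex.Re (F z)).

(** Since U tends to 0, the mean value theorem gives U(s) <= (-l + eps)(1 - s) for s near 1. Then
    [harnack_monotone] transports this linear decay from the end of the radius to every r; the 2
    bounds the factor 1 + s. The sign of [l] follows from the case r = 0, where U >= 0. *)
Lemma radial_boundary_bound e (l : R) : cmod e = 1 ->
  complex.Re (F (r%:C * e)) @[r --> at_left 1] --> (0 : R) ->
  complex.Re (dF (r%:C * e) * e) @[r --> at_left 1] --> l ->
  l <= 0 /\ forall r : R, 0 <= r < 1 ->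
    complex.Re (F (r%:C * e)) * (1 + r) <= 2 * (- l) * (1 - r).
Proof.
move=> e1 /at_left1P U0 /at_left1P Dl.
pose U (r : R) := complex.Re (F (r%:C * e)).
have ct t : 0 <= t -> t < 1 -> cmod (t%:C * e) < 1.
  by move=> t0 t1; rewrite cmodM e1 mulr1 cmodR ger0_norm.
have Ug t : 0 <= t -> t < 1 -> 0 <= U t by move=> t0 t1; apply: F0; exact: ct.
have near1 (eps : R) : 0 < eps -> exists2 d : R, 0 < d <= 1 &
    forall r, 1 - d < r < 1 -> U r <= (- l + eps) * (1 - r).
  move=> eps0; have [d d0 Hd] := Dl _ eps0.
  exists (Num.min d 1) => [|r /andP[rd r1]]; first by rewrite lt_min d0 ltr01 ge_min lexx orbT.
  have [rd' r0] : 1 - d < r /\ 0 < r.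
    by move: rd; have : Num.min d 1 <= d /\ Num.min d 1 <= 1; [rewrite !ge_min !lexx orbT|lra].
  have K0 : 0 < `|- l + eps| + 1 by rewrite ltr_wpDl.
  apply/ler_addgt0Pr => eta eta0.
  have eta2 : 0 < eta / 2 by rewrite divr_gt0.
  have [d' d'0 Hd'] := U0 _ eta2.
  (* [s] is so close to 1 that U(s) and the missing piece of length 1 - s each cost at most
     [eta / 2]; the added 1 keeps the denominator positive. *)
  pose m := Num.max (1 - d') (Num.max r (1 - eta / 2 / (`|- l + eps| + 1))).
  pose s := (m + 1) / 2.
  have m1 : m < 1.
    rewrite !gt_max r1; apply/andP; split; first by lra.
    have := divr_gt0 eta2 K0; lra.
  have [m2 m3 m4] : [/\ 1 - d' <= m, r <= m & 1 - eta / 2 / (`|- l + eps| + 1) <= m].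
    by rewrite /m !le_max !lexx !orbT.
  have rs : r < s by rewrite /s; lra.
  have s1 : s < 1 by rewrite /s; lra.
  have Us : U s < eta / 2.
    have := Hd' s; rewrite subr0 => H; apply: le_lt_trans (ler_norm _) (H _).
    by rewrite /s; apply/andP; split; lra.
  have [x /andP[rx xs]] : exists2 x,
    r < x < s & U s - U r = complex.Re (dF (x%:C * e) * e) * (s - r).
    apply: is_derive_MVT => // x /andP[rx xs].
    have cx : cmod (0 + x%:C * e) < 1 by rewrite add0r ct; lra.
    have := is_derive_Re_line (FdF cx).1.
    by rewrite add0r; under eq_fun do rewrite add0r.
  have := Hd x; rewrite ltr_norml => H.
  have /andP[H1 _] := H ltac:(apply/andP; split; lra).
  set D := complex.Re _ in H1 * => UE.
  have sr : s - r > 0 by rewrite subr_gt0.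
  have step : U r <= U s + (- l + eps) * (s - r).
    have : - eps * (s - r) <= (D - l) * (s - r) by rewrite ler_wpM2r // ltW.
    by move: UE; rewrite !mulrDl !mulNr; lra.
  have tail : - ((- l + eps) * (1 - s)) <= eta / 2.
    have h1 : 1 - s <= eta / 2 / (`|- l + eps| + 1) by rewrite /s; lra.
    have := ler_norm (- (- l + eps)); rewrite normrN => h2.
    have : (1 - s) * (`|- l + eps| + 1) <= eta / 2 by rewrite -ler_pdivlMr.
    have : 0 <= 1 - s by lra.
    by move: h2; move: (`|_|) => k; nra.
  have -> : (- l + eps) * (1 - r) = (- l + eps) * (s - r) + (- l + eps) * (1 - s) by ring.
  lra.
have bound (eps r : R) : 0 < eps -> 0 <= r -> r < 1 ->
  U r * (1 + r) <= 2 * (- l + eps) * (1 - r).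
  move=> eps0 r0 r1; have [d /andP[d0 d1] Hd] := near1 _ eps0.
  (* A point beyond [r] at which the linear bound of [near1] is available. *)
  pose s := Num.max r (1 - d / 2).
  have rs : r <= s by rewrite le_max lexx.
  have s1 : s < 1 by rewrite gt_max r1; lra.
  have sd : 1 - d < s by rewrite lt_max; apply/orP; right; lra.
  have := Hd s; rewrite sd s1 => /(_ isT) Us.
  have := harnack_monotone FdF F0 e1 r0 rs s1; rewrite -/(U r) -/(U s) => Hk.
  have s0 : 0 < 1 - s by lra.
  have r0' : 0 < 1 - r by lra.
  have k0 : 0 <= - l + eps.
    by have := le_trans (Ug s (le_trans r0 rs) s1) Us; rewrite pmulr_lge0.
  rewrite -(ler_pM2r s0) -[U r * _ * _]mulrA; apply: (le_trans Hk).
  have : U s * ((1 + s) * (1 - r)) <= (- l + eps) * (1 - s) * ((1 + s) * (1 - r)).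
    by apply: ler_wpM2r => //; rewrite mulr_ge0; lra.
  move=> /le_trans; apply.
  have -> : (- l + eps) * (1 - s) * ((1 + s) * (1 - r)) = (- l +
    eps) * (1 - s) * (1 - r) * (1 + s) by ring.
  have -> : 2 * (- l + eps) * (1 - r) * (1 - s) = (- l + eps) * (1 - s) * (1 - r) * 2 by ring.
  by apply: ler_wpM2l; [rewrite !mulr_ge0 // ltW|lra].
have l0 : l <= 0.
  rewrite -oppr_ge0; apply/ler_addgt0Pr => eps eps0.
  have := bound eps 0 eps0 (lexx 0) ltr01; have := Ug 0 (lexx 0) ltr01.
  rewrite addr0 subr0 !mulr1; lra.
split=> // r /andP[r0 r1]; apply/ler_addgt0Pr => eps eps0.
have := bound (eps / 2) r (divr_gt0 eps0 (ltr0n _ 2)) r0 r1; rewrite -/(U r).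
have : eps * (1 - r) <= eps * 1 by apply: ler_wpM2l; lra.
by rewrite [2 * (_ + _)]mulrDr [2 * (eps / 2)]mulrC divfK // [(_ + eps) * _]mulrDl; lra.
Qed.

End Boundary.

(** * Nonnegative harmonic functions whose boundary mass sits at two points *)

Section TwoAtoms.
Variable R : realType.
Local Notation C := R[i].
Local Notation om := (root_of_unity R).
Implicit Types (z w e : C).

Lemma poisson_kernel0 e : cmod e = 1 -> poisson_kernel 0 e = 1.
Proof.
move=> e1; have e0 : e != 0 := circle_neq0 e1.
by rewrite /poisson_kernel addr0 subr0 divff.
Qed.

(** The point b/2 separates the two atoms: the kernel of [b] is 3 there, and a circle point whose
    kernel is 3 is at distance 1/2 from b/2, hence is [b] itself. *)
Lemma poisson_kernel_half (a b : C) : cmod a = 1 -> cmod b = 1 -> a != b ->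
  poisson_kernel (b / 2) a != poisson_kernel (b / 2) b.
Proof.
move=> a1 b1 ab.
have b0 : b != 0 := circle_neq0 b1.
have -> : poisson_kernel (b / 2) b = 3.
  rewrite /poisson_kernel (_ : _ / _ = 3%:R%:C) // rmorph_nat.
  have -> : b - b / 2 = b / 2 by field.
  have -> : b + b / 2 = 3%:R * (b / 2) by field.
  by rewrite mulfK // mulf_neq0 // invr_eq0 pnatr_eq0.
have h2 : (2 : C) = (2%:R : R)%:C by rewrite rmorph_nat.
have c2 : cmod (b / 2) = 2^-1 by rewrite cmodM b1 mul1r cmodV h2 cmodR ger0_norm.
have ab2 : a != b / 2.
  apply/eqP => E; move: a1; rewrite E c2 => H.
  lra.
rewrite poisson_kernelE // c2; apply/eqP => E.
have d0 : cmod (a - b / 2) ^+ 2 != 0 by rewrite expf_neq0 // cmod_eq0 subr_eq0.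
have {}E : cmod (a - b / 2) ^+ 2 = 4^-1.
  move: E => /(congr1 (fun x => x * cmod (a - b / 2) ^+ 2)); rewrite divfK //; lra.
move/eqP: ab; apply; apply/eqP; rewrite -subr_eq0 -cmod_eq0 -sqrf_eq0; apply/eqP.
have b2 : b / 2 = (2^-1)%:C * b by rewrite mulrC fmorphV rmorph_nat.
have := sqr_cmod a; have := sqr_cmod b; rewrite a1 b1; move: E; rewrite b2 !sqr_cmod.
by case: a b {a1 b1 b0 c2 ab2 d0 h2 b2} => x y [x' y']; rewrite /= !mul0r subr0 addr0; lra.
Qed.

Lemma poisson_kernel_continuous z (a : C) (d : R) : cmod z < 1 -> cmod a = 1 -> 0 < d ->
  exists2 eps : R, 0 < eps & forall e, cmod (e - a) < eps ->
    `|poisson_kernel z e - poisson_kernel z a| <= d.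
Proof.
move=> z1 a1 d0; have az : a - z != 0.
  by rewrite subr_eq0; apply/eqP => E; move: z1; rewrite -E a1 ltxx.
have N : cder (fun e => e + z) a (1 + 0) by exact (cderD (cder_id a) (cder_cst z a)).
have D : cder (fun e => e - z) a (1 - 0) by exact (cderB (cder_id a) (cder_cst z a)).
have [eps eps0 He] := iffLR (continuousCP _ _) (cder_continuous (@cder_div _ (fun e => e +
  z) (fun e => e - z) a _ _ az N D)) d d0.
exists eps => // e /He; rewrite -ReB => /ltW; apply: le_trans; exact: normRe_le.
Qed.

Lemma poisson_kernel_le z e : cmod z < 1 -> cmod e = 1 ->
  `|poisson_kernel z e| <= 2 / (1 - cmod z).
Proof.
move=> z1 e1; apply: (le_trans (normRe_le _)); rewrite cmodM cmodV.
have h := cmodD (e - z) z; rewrite subrK e1 in h.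
have h' : cmod (e + z) <= 2 by apply: (le_trans (cmodD _ _)); rewrite e1; lra.
have zz := cmod_ge0 z.
apply: ler_pM; rewrite ?cmod_ge0 ?invr_ge0 ?cmod_ge0 //.
by rewrite lef_pV2 ?posrE; lra.
Qed.

(** Takes the place of a weak limit of measures. [U0], [U1], [U2] stand for the values at 0, b/2 and
    z. The kernels are 1 at 0, so the first two values form a linear system of determinant [B1 - A1]
    for the masses; the approximate masses converge to its solution, which does not depend on z. *)
Lemma two_atoms_closure (A1 B1 A2 B2 U0 U1 U2 : R) : A1 != B1 ->
  (forall d : R, 0 < d -> exists Ma Mb : R, [/\ 0 <= Ma, 0 <= Mb, `|U0 - Ma - Mb| <= d,
    `|U1 - A1 * Ma - B1 * Mb| <= d & `|U2 - A2 * Ma - B2 * Mb| <= d]) ->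
  let beta := (U1 - A1 * U0) / (B1 - A1) in let alpha := U0 - beta in
  [/\ 0 <= alpha, 0 <= beta & U2 = alpha * A2 + beta * B2].
Proof.
move=> AB H beta alpha.
have BA : B1 - A1 != 0 by rewrite subr_eq0 eq_sym.
pose c := (1 + `|A1|) / `|B1 - A1|.
have c0 : 0 <= c by rewrite divr_ge0 // addr_ge0.
have close (d : R) : 0 < d -> exists Ma Mb : R, [/\ 0 <= Ma, 0 <= Mb,
  `|alpha - Ma| <= d * (1 + c),
    `|beta - Mb| <= d * c & `|U2 - A2 * Ma - B2 * Mb| <= d].
  move=> d0; have [Ma [Mb [Ma0 Mb0 h0 h1 h2]]] := H d d0; exists Ma, Mb.
  have hb : `|beta - Mb| <= d * c.
    have -> : beta - Mb = ((U1 - A1 * Ma - B1 * Mb) - A1 * (U0 - Ma - Mb)) / (B1 - A1).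
      by rewrite /beta; field.
    rewrite normrM normfV /c mulrA ler_wpM2r ?invr_ge0 //.
    apply: (le_trans (ler_normB _ _)); rewrite [d * _]mulrDr mulr1 normrM lerD // [d * _]mulrC.
    by rewrite ler_wpM2l.
  split=> //; have -> : alpha - Ma = (U0 - Ma - Mb) - (beta - Mb) by rewrite /alpha; ring.
  by apply: (le_trans (ler_normB _ _)); rewrite [d * _]mulrDr mulr1 lerD.
have small (x y : R) (K : R) : 0 <= K -> (forall d : R, 0 < d -> x <= y + d * K) -> x <= y.
  move=> K0 h; apply/ler_addgt0Pr => e e0; have K1 : 0 < K + 1 by lra.
  apply: (le_trans (h (e / (K + 1)) (divr_gt0 e0 K1))); rewrite lerD2l.
  by rewrite mulrAC ler_pdivrMr // ler_wpM2l ?(ltW e0) // lerDl.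
split.
- apply: (small _ _ (1 + c)); first by lra.
  move=> d /close[Ma [Mb [Ma0 _ + _ _]]]; rewrite ler_norml => /andP[? ?]; lra.
- apply: (small _ _ c) => //.
  move=> d /close[Ma [Mb [_ Mb0 _ + _]]]; rewrite ler_norml => /andP[? ?]; lra.
- apply/eqP; rewrite -subr_eq0 -normr_le0.
  apply: (small _ _ (1 + `|A2| * (1 + c) + `|B2| * c)).
    by rewrite !addr_ge0 // ?mulr_ge0 // addr_ge0.
  move=> d /close[Ma [Mb [_ _ h1 h2 h3]]]; rewrite add0r.
  have -> : U2 - (alpha * A2 + beta * B2) =
    (U2 - A2 * Ma - B2 * Mb) - A2 * (alpha - Ma) - B2 * (beta - Mb) by ring.
  have -> : d * (1 + `|A2| * (1 + c) + `|B2| * c) = d + `|A2| * (d * (1 + c)) +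
    `|B2| * (d * c) by ring.
  apply: (le_trans (ler_normB _ _)); apply: lerD; last by rewrite normrM ler_wpM2l.
  by apply: (le_trans (ler_normB _ _)); rewrite lerD // normrM ler_wpM2l.
Qed.

Variables (F dF : C -> C) (a b : C).
Hypotheses (FdF : holo_disk 1 F dF) (F0 : forall z, cmod z < 1 -> 0 <= complex.Re (F z)).
Hypotheses (a1 : cmod a = 1) (b1 : cmod b = 1) (ab : a != b).
Hypothesis away : forall eps : R, 0 < eps -> exists2 K : R, 0 <= K &
  forall (t r : R), eps <= cmod (expi t - a) -> eps <= cmod (expi t - b) -> 0 <= r < 1 ->
    complex.Re (F (r%:C * expi t)) <= K * (1 - r).

Let U z := complex.Re (F z).
(** The masses that the weights U(rho w^k)/N put near [a] and near [b]. The second sum omits the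
    points near [a], so that no point counts twice however large [eps] is. *)
Let mass_a (eps rho : R) N := N%:R^-1 * \sum_(k < N) (if cmod (om N ^+ k -
  a) < eps then U (rho%:C * om N ^+ k) else 0).
Let mass_b (eps rho : R) N := N%:R^-1 * \sum_(k < N)
  (if (eps <= cmod (om N ^+ k - a)) && (cmod (om N ^+ k -
    b) < eps) then U (rho%:C * om N ^+ k) else 0).

(** Small arcs make the kernel nearly constant on each, then [rho] near 1 removes the mass off the
    arcs by [away], then a large [N] brings in the Poisson formula. Thresholds are returned so that
    one triple [eps], [rho], [N] can serve several points; [N0 < N] is strict to make [N]
    positive. *)
Lemma two_atoms_approx z (d : R) : cmod z < 1 -> 0 < d ->
  exists2 eps0 : R, 0 < eps0 & forall eps, 0 < eps < eps0 ->
  exists2 rho0 : R, rho0 < 1 & forall rho, 0 < rho -> rho0 < rho < 1 ->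
  exists N0, forall N, (N0 < N)%N ->
  `|U z - poisson_kernel z a * mass_a eps rho N - poisson_kernel z b * mass_b eps rho N| <= d.
Proof.
move=> z1 d0.
have c0 : cmod (0 : C) < 1 by rewrite cmod0.
have U0 : 0 <= U 0 by exact: F0.
(* The termwise errors add up to [d' * (U 0 + 2)]; the Poisson formula and the passage from rho z to
   z cost [d'] each. *)
pose d' := d / (U 0 + 4); have d'0 : 0 < d' by rewrite divr_gt0 //; lra.
have [ea ea0 Ha] := poisson_kernel_continuous z1 a1 d'0.
have [eb eb0 Hb] := poisson_kernel_continuous z1 b1 d'0.
exists (Num.min ea eb) => [|eps /andP[eps0]]; first by rewrite lt_min ea0.
rewrite lt_min => /andP[epsa epsb].
have [K K0 HK] := away eps0.
have [p p1 Hp] := radial_cvg FdF z1 d'0.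
pose Mz := 2 / (1 - cmod z); have Mz0 : 0 <= Mz by rewrite divr_ge0 // subr_ge0 ltW.
have MK : 0 < Mz * K + 1 by rewrite ltr_wpDl // mulr_ge0.
exists (Num.max p (1 - d' / (Mz * K + 1))) => [|rho rho0 /andP[]].
  by rewrite gt_max p1 /= ltrBlDr ltrDl divr_gt0.
rewrite gt_max => /andP[prho rhoK] rho1.
have rho01 : 0 < rho < 1 by rewrite rho0.
have {}rhoK : Mz * K * (1 - rho) <= d'.
  have : (1 - rho) * (Mz * K + 1) <= d' by rewrite -ler_pdivlMr //; lra.
  have : 0 <= 1 - rho by lra.
  by rewrite mulrDr mulr1 [(1 - rho) * _]mulrC; lra.
have [N1 H1] := scaled_poisson FdF rho01 z1 d'0.
have [N2 H2] := scaled_poisson FdF rho01 c0 ltr01.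
exists (maxn N1 N2) => N; rewrite gtn_max => /andP[/ltnW/H1 h1 NN2].
have N0 : 0 < N%:R :> R by rewrite ltr0n (leq_trans _ NN2).
have := H2 N (ltnW NN2); rewrite mulr0 mulr1.
under eq_bigr do rewrite poisson_kernel0 ?cmod_root_of_unityX // mul1r.
rewrite ler_norml => /andP[_ h2]; rewrite -/(U 0) in h2.
set w := om N in h1 h2 *.
pose u k := U (rho%:C * w ^+ k).
have u0 k : 0 <= u k by apply: F0; rewrite cmodM cmod_root_of_unityX mulr1 cmodR gtr0_norm.
pose ma k := if cmod (w ^+ k - a) < eps then u k else 0.
pose mb k := if (eps <= cmod (w ^+ k - a)) && (cmod (w ^+ k - b) < eps) then u k else 0.
pose q k := poisson_kernel z (w ^+ k).
have term k : `|q k * u k - poisson_kernel z a * ma k - poisson_kernel z b * mb k| <=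
  d' * u k + d'.
  have [wa|wa] := ltP (cmod (w ^+ k - a)) eps.
    have -> : mb k = 0 by rewrite /mb leNgt wa.
    have -> : ma k = u k by rewrite /ma wa.
    rewrite mulr0 subr0 -mulrBl normrM (ger0_norm (u0 k)).
    have := Ha _ (lt_trans wa epsa) => h.
    by apply: (@le_trans _ _ (d' * u k)); [exact: ler_wpM2r|rewrite lerDl ltW].
  have -> : ma k = 0 by rewrite /ma ltNge wa.
  have [wb|wb] := ltP (cmod (w ^+ k - b)) eps.
    have -> : mb k = u k by rewrite /mb wa wb.
    rewrite mulr0 subr0 -mulrBl normrM (ger0_norm (u0 k)).
    have := Hb _ (lt_trans wb epsb) => h.
    by apply: (@le_trans _ _ (d' * u k)); [exact: ler_wpM2r|rewrite lerDl ltW].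
  have -> : mb k = 0 by rewrite /mb ltNge wb andbF.
  rewrite !mulr0 !subr0 normrM (ger0_norm (u0 k)).
  have uK : u k <= K * (1 - rho).
    by rewrite /u expiX; apply: HK; rewrite -?expiX // (ltW rho0).
  have qM : `|q k| <= Mz by apply: poisson_kernel_le => //; exact: cmod_root_of_unityX.
  apply: (@le_trans _ _ (Mz * (K * (1 - rho)))); first exact: ler_pM.
  by rewrite mulrA; apply: (le_trans rhoK); rewrite lerDr mulr_ge0 // ltW.
have total : `|\sum_(k < N) q k * u k - poisson_kernel z a * \sum_(k < N) ma k -
  poisson_kernel z b * \sum_(k < N) mb k|
    <= N%:R * (d' * (U 0 + 2)).
  rewrite !mulr_sumr -!sumrB; apply: (le_trans (ler_norm_sum _ _ _)).
  apply: (@le_trans _ _ (\sum_(k < N) (d' * u k + d'))); first by apply: ler_sum.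
  rewrite big_split /= -mulr_sumr sumr_const card_ord -[_ *+ N]mulr_natl.
  have : d' * \sum_(k < N) u k <= d' * (N%:R * U 0 + N%:R).
    by rewrite ler_wpM2l ?(ltW d'0) //; move: h2; rewrite /u; lra.
  lra.
have Uz := ltW (Hp rho ltac:(by rewrite prho)).
rewrite -(ler_pM2l N0).
set Pa := poisson_kernel z a in total *; set Pb := poisson_kernel z b in total *.
have -> : N%:R * `|U z - Pa * mass_a eps rho N - Pb * mass_b eps rho N| =
   `|N%:R * U z - Pa * \sum_(k < N) ma k - Pb * \sum_(k < N) mb k|.
  rewrite -{1}(ger0_norm (ltW N0)) -normrM /mass_a /mass_b -/w.
  congr (`|_|); rewrite -/(ma) -/(mb); field; exact: lt0r_neq0.
have -> : N%:R * U z - Pa * \sum_(k < N) ma k - Pb * \sum_(k < N) mb k =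
  (\sum_(k < N) q k * u k - Pa * \sum_(k < N) ma k - Pb * \sum_(k < N) mb k)
  - (\sum_(k < N) q k * u k - N%:R * U (rho%:C * z)) - N%:R * (U (rho%:C * z) - U z) by ring.
apply: (le_trans (ler_normB _ _)); apply: (le_trans (lerD (ler_normB _ _) (lexx _))).
have h3 : `|N%:R * (U (rho%:C * z) - U z)| <= N%:R * d'.
  by rewrite normrM ger0_norm ?(ltW N0) // ler_wpM2l ?(ltW N0).
have -> : N%:R * d = N%:R * (d' * (U 0 + 2)) + N%:R * d' + N%:R * d'.
  by rewrite /d'; field; rewrite gt_eqF //; lra.
by apply: lerD => //; apply: lerD.
Qed.

Lemma two_atoms : exists alpha beta : R, [/\ 0 <= alpha, 0 <= beta &
  forall z, cmod z < 1 -> complex.Re (F z) = alpha * poisson_kernel z a +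
    beta * poisson_kernel z b].
Proof.
have c0 : cmod (0 : C) < 1 by rewrite cmod0.
have c2 : cmod (b / 2) < 1.
  have h2 : (2 : C) = (2%:R : R)%:C by rewrite rmorph_nat.
  by rewrite cmodM b1 mul1r cmodV h2 cmodR ger0_norm //; lra.
have AB := poisson_kernel_half a1 b1 ab.
have H z : cmod z < 1 -> forall d : R, 0 < d ->
  exists Ma Mb : R, [/\ 0 <= Ma, 0 <= Mb, `|U 0 - Ma - Mb| <= d,
    `|U (b / 2) - poisson_kernel (b / 2) a * Ma - poisson_kernel (b / 2) b * Mb| <= d &
    `|U z - poisson_kernel z a * Ma - poisson_kernel z b * Mb| <= d].
  move=> z1 d d0.
  have [e1 e10 H1] := two_atoms_approx c0 d0.
  have [e2 e20 H2] := two_atoms_approx c2 d0.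
  have [e3 e30 H3] := two_atoms_approx z1 d0.
  pose m := Num.min e1 (Num.min e2 e3); pose eps := m / 2.
  have m0 : 0 < m by rewrite !lt_min e10 e20.
  have [m1 m2 m3] : [/\ m <= e1, m <= e2 & m <= e3] by rewrite /m !ge_min !lexx !orbT.
  have [r1 r11 {}H1] := H1 eps ltac:(rewrite /eps; apply/andP; split; lra).
  have [r2 r21 {}H2] := H2 eps ltac:(rewrite /eps; apply/andP; split; lra).
  have [r3 r31 {}H3] := H3 eps ltac:(rewrite /eps; apply/andP; split; lra).
  pose M := Num.max 0 (Num.max r1 (Num.max r2 r3)); pose rho := (M + 1) / 2.
  have M1 : M < 1 by rewrite !gt_max ltr01 r11 r21.
  have [M0 M2 M3 M4] : [/\ 0 <= M, r1 <= M, r2 <= M & r3 <= M]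
    by rewrite /M !le_max !lexx !orbT.
  have rho0 : 0 < rho by rewrite /rho; lra.
  have rho1 : rho < 1 by rewrite /rho; lra.
  have [N1 {}H1] := H1 rho rho0 ltac:(rewrite rho1 andbT /rho; lra).
  have [N2 {}H2] := H2 rho rho0 ltac:(rewrite rho1 andbT /rho; lra).
  have [N3 {}H3] := H3 rho rho0 ltac:(rewrite rho1 andbT /rho; lra).
  pose N := (maxn N1 (maxn N2 N3)).+1.
  have [n1 n2 n3] : [/\ (N1 < N)%N, (N2 < N)%N & (N3 < N)%N].
    by rewrite /N !ltnS !leq_max !leqnn !orbT.
  have u0 k : 0 <= U (rho%:C * om N ^+ k).
    by apply: F0; rewrite cmodM cmod_root_of_unityX mulr1 cmodR gtr0_norm.
  exists (mass_a eps rho N), (mass_b eps rho N); split.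
  - by rewrite mulr_ge0 ?invr_ge0 // sumr_ge0 // => k _; case: ifP.
  - by rewrite mulr_ge0 ?invr_ge0 // sumr_ge0 // => k _; case: ifP.
  - by have := H1 N n1; rewrite !poisson_kernel0 // !mul1r.
  - exact: H2.
  - exact: H3.
have sol z (z1 : cmod z < 1) := two_atoms_closure AB (H z z1).
set A1 := poisson_kernel (b / 2) a in sol; set B1 := poisson_kernel (b / 2) b in sol.
pose beta := (U (b / 2) - A1 * U 0) / (B1 - A1).
(* These weights come from the values at 0 and b/2 alone, so one pair serves every [z]. *)
exists (U 0 - beta), beta; have [h1 h2 _] := sol 0 c0.
by split=> // z /sol[].
Qed.

End TwoAtoms.

(** * Polynomials on the circle *)

Section CirclePolynomials.
Variable R : realType.
Local Notation C := R[i].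
Implicit Types (p q A B : {poly C}) (z e : C).

(** Split [q] into linear factors and multiply their lower bounds. *)
Lemma poly_lower_bound q (S : C -> Prop) : q != 0 ->
  (forall r, root q r -> exists2 c : R, 0 < c & forall e, S e -> c <= cmod (e - r)) ->
  exists2 c : R, 0 < c & forall e, S e -> c <= cmod q.[e].
Proof.
move=> q0 H; have [rs qE] := closed_field_poly_normal q.
have lc0 : 0 < cmod (lead_coef q) by rewrite cmod_gt0 lead_coef_eq0.
have {}H r : r \in rs -> exists2 c : R, 0 < c & forall e, S e -> c <= cmod (e - r).
  move=> rrs; apply: H; rewrite qE rootZ ?lead_coef_eq0 //.
  by rewrite root_prod_XsubC.
have [c c0 Hc] : exists2 c : R, 0 < c & forall e, S e ->
  c <= cmod (\prod_(r <- rs) ('X - r%:P)).[e].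
  elim: rs H {qE} => [|r rs IH] H.
    by exists 1 => // e _; rewrite big_nil hornerC cmod1.
  have [c c0 Hc] := H r (mem_head _ _).
  have [|c' c'0 Hc'] := IH; first by move=> x xrs; apply: H; rewrite inE xrs orbT.
  exists (c * c') => [|e Se]; first exact: mulr_gt0.
  by rewrite big_cons hornerM hornerXsubC cmodM; apply: ler_pM;
    [exact: ltW|exact: ltW|exact: Hc|exact: Hc'].
exists (cmod (lead_coef q) * c) => [|e Se]; first exact: mulr_gt0.
by rewrite {2}qE hornerZ cmodM ler_pM2l // Hc.
Qed.

Lemma poly_upper_bound p : exists2 K : R, 0 <= K & forall e, cmod e <= 1 -> cmod p.[e] <= K.
Proof.
elim/poly_ind: p => [|p c [K K0 IH]].
  by exists 0 => // e _; rewrite horner0 cmod0.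
exists (K + cmod c) => [|e e1]; first by rewrite addr_ge0 ?cmod_ge0.
rewrite hornerMXaddC; apply: (le_trans (cmodD _ _)); rewrite lerD2r cmodM.
by rewrite -[K]mulr1; apply: ler_pM; rewrite ?cmod_ge0 ?IH.
Qed.

Lemma poly_circle_eq0 p : (forall t : R, p.[expi t] = 0) -> p = 0.
Proof.
move=> H; apply/eqP; apply: contraT => p0.
pose n := size p; have n0 : (0 < n)%N by rewrite size_poly_gt0.
(* The angles [k / n] lie in [0, 1[, inside [0, pi], where the cosine is injective; this gives as
   many roots as the size of [p], one too many. *)
pose pt (k : nat) : C := expi (k%:R / n%:R).
have : (size [seq pt k | k <- iota 0 n] < size p)%N.
  apply: max_poly_roots => //.
    by apply/allP => x /mapP[k _ ->]; rewrite /root H.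
  rewrite map_inj_in_uniq ?iota_uniq // => i j.
  rewrite !mem_iota !add0n => /andP[_ i_n] /andP[_ j_n] [cE _].
  have nn : 0 < n%:R :> R by rewrite ltr0n.
  have in0pi k : (k < n)%N -> (k%:R / n%:R : R) \in `[0, pi].
    move=> kn; rewrite in_itv /= divr_ge0 // ler_pdivrMr //=.
    apply: (@le_trans _ _ (1 * n%:R)); first by rewrite mul1r ler_nat ltnW.
    by rewrite ler_pM2r //; have := @pi_ge2 R; lra.
  have := congr1 (@acos R) cE; rewrite !cosK ?in0pi // => /divIf.
  by move=> /(_ (lt0r_neq0 nn))/eqP; rewrite eqr_nat => /eqP.
by rewrite size_map size_iota ltnn.
Qed.

(** The reciprocal polynomial. On the circle it equals e^deg times the conjugate of p(e), so that
    |p(e)|^2 becomes polynomial up to a power of e. *)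
Definition conj_reverse p : {poly C} :=
  \sum_(i < size p) conjc p`_i *: 'X^((size p).-1 - i).

Lemma conj_reverseE p z : z != 0 ->
  (conj_reverse p).[z] = z ^+ (size p).-1 * conjc p.[(conjc z)^-1].
Proof.
move=> z0; rewrite /conj_reverse horner_sum horner_coef rmorph_sum /= mulr_sumr.
apply: eq_bigr => i _; rewrite hornerZ hornerXn conjcM rmorphXn /= conjc_inv conjcK.
rewrite mulrCA; congr (_ * _); rewrite exprVn; apply: expfB_cond.
by rewrite (negbTE z0) add0n; have := ltn_ord i; lia.
Qed.

Lemma conj_reverse_circle p e : cmod e = 1 ->
  (conj_reverse p).[e] = e ^+ (size p).-1 * conjc p.[e].
Proof.
move=> e1; have e0 : e != 0 := circle_neq0 e1.
rewrite conj_reverseE //; congr (_ * conjc _.[_]); apply: (mulIf (_ : conjc e != 0)).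
  by rewrite conjc_eq0.
by rewrite mulVf ?conjc_eq0 // -sqr_cmodC e1 expr1n.
Qed.

(** The equality of moduli becomes the polynomial identity [Z = 0], the powers of ['X] balancing the
    degrees. At a root x of [A] one has |x| >= 1 and B(x) != 0, so B vanishes at 1/conj x. This
    point is not in the open disk, so |x| = 1 and 1/conj x = x, a contradiction. *)
Lemma proportional_modulus_constant A B (g : {poly C}) (k : R) : coprimep A B -> g != 0 ->
  k != 0 ->
  (forall z, cmod z < 1 -> A.[z] != 0) -> (forall z, cmod z < 1 -> B.[z] != 0) ->
  (forall t, cmod (A * g).[expi t] = k * cmod (B * g).[expi t]) -> size A = 1%N.
Proof.
move=> copAB g0 k0 A0 B0 AB.
pose Z := A * conj_reverse A * 'X^((size B).-1) -
  (k ^+ 2)%:C *: (B * conj_reverse B * 'X^((size A).-1)).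
have Z0 : Z = 0.
  apply/eqP; suff : Z * g == 0 by rewrite mulf_eq0 (negbTE g0) orbF.
  apply/eqP/poly_circle_eq0 => t; have := AB t; rewrite !hornerM !cmodM mulrA => ABt.
  have [gt|gt] := eqVneq g.[expi t] 0; first by rewrite gt mulr0.
  have {}ABt : cmod A.[expi t] = k * cmod B.[expi t].
    by apply: (mulIf (_ : cmod g.[expi t] != 0)) ABt; rewrite cmod_eq0.
  rewrite /Z hornerD hornerN hornerZ !hornerM !hornerXn !conj_reverse_circle ?cmod_expi //.
  set x := A.[_] in ABt *; set y := B.[_] in ABt *; set ex := expi t.
  have -> : x * (ex ^+ (size A).-1 * conjc x) * ex ^+ (size B).-1
    - (k ^+ 2)%:C * (y * (ex ^+ (size B).-1 * conjc y) * ex ^+ (size A).-1) =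
    ex ^+ (size A).-1 * ex ^+ (size B).-1 * (x * conjc x - (k ^+ 2)%:C * (y * conjc y))
      by ring.
  by rewrite -!sqr_cmodC ABt exprMn [(k ^+ 2 * _)%:C]rmorphM /= subrr mulr0 mul0r.
apply/eqP; apply: contraT => /closed_rootP[x]; rewrite -/(root A x) => /[dup] rAx /eqP Ax.
have x1 : 1 <= cmod x by rewrite leNgt; apply/negP => /A0; rewrite Ax eqxx.
have x0 : x != 0 by rewrite -cmod_gt0 (lt_le_trans ltr01).
have Bx : B.[x] != 0 by have := coprimep_root copAB rAx.
have k20 : (k ^+ 2)%:C != 0 by rewrite (fmorph_eq0 (real_complex R)) expf_neq0.
have := congr1 (horner^~ x) Z0;
  rewrite horner0 /Z hornerD hornerN hornerZ !hornerM !hornerXn Ax !mul0r sub0r.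
move/eqP; rewrite oppr_eq0 !mulf_eq0 (negbTE k20) (negbTE Bx) expf_eq0
  (negbTE x0) andbF orbF /=.
rewrite conj_reverseE // mulf_eq0 expf_eq0 (negbTE x0) andbF /= conjc_eq0 => /eqP Bxi.
have cx : cmod (conjc x)^-1 = (cmod x)^-1 by rewrite cmodV cmod_conj.
have x1' : cmod x = 1.
  apply/le_anti; rewrite x1 andbT leNgt; apply/negP => lt1x.
  by have := B0 (conjc x)^-1; rewrite Bxi eqxx cx invf_lt1 ?(lt_trans ltr01) // => /(_ lt1x).
have xi : (conjc x)^-1 = x.
  apply: (mulIf (_ : conjc x != 0)); first by rewrite conjc_eq0.
  by rewrite mulVf ?conjc_eq0 // -sqr_cmodC x1' expr1n.
by move: Bx; rewrite -{1}xi Bxi eqxx.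
Qed.

(** A rational function without zeros or poles in the disk and of constant modulus on the circle is
    constant. Zeros on the circle are allowed; the common ones go into the gcd, and the quotients
    turn out to be constants. *)
Lemma proportional_modulus A B (k : R) : A != 0 -> k != 0 ->
  (forall z, cmod z < 1 -> A.[z] != 0) -> (forall z, cmod z < 1 -> B.[z] != 0) ->
  (forall t, cmod A.[expi t] = k * cmod B.[expi t]) -> exists2 c : C, c != 0 & A = c *: B.
Proof.
move=> nA k0 A0 B0 AB.
pose g := gcdp A B; have g0 : g != 0 by rewrite gcdp_eq0 (negbTE nA).
pose M := A %/ g; pose N := B %/ g.
have AE : A = M * g by rewrite divpK ?dvdp_gcdl.
have BE : B = N * g by rewrite divpK ?dvdp_gcdr.
have copMN : coprimep M N by apply: coprimep_div_gcd; rewrite nA.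
have M0 z : cmod z < 1 -> M.[z] != 0.
  by move=> /A0; rewrite AE hornerM mulf_eq0 negb_or => /andP[].
have N0 z : cmod z < 1 -> N.[z] != 0.
  by move=> /B0; rewrite BE hornerM mulf_eq0 negb_or => /andP[].
have sM : size M = 1%N.
  by apply: (@proportional_modulus_constant M N g k) => // t; rewrite -AE -BE.
have sN : size N = 1%N.
  apply: (@proportional_modulus_constant N M g k^-1); rewrite ?invr_eq0 1?coprimep_sym // => t.
  by rewrite -AE -BE AB mulKf.
have [c c0 Mc] := size_poly1P _ (introT eqP sM).
have [d d0 Nd] := size_poly1P _ (introT eqP sN).
exists (c / d); first by rewrite mulf_neq0 ?invr_eq0.
by rewrite AE {1}BE Mc Nd !mul_polyC scalerA divfK.
Qed.

End CirclePolynomials.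

(** * The strip model *)

Section ComplexExponential.
Variable R : realType.
Local Notation C := R[i].
Implicit Types (z w e : C).

Lemma realcM (x y : R) : (x * y)%:C = x%:C * y%:C.
Proof. exact: rmorphM. Qed.

Lemma realcV (x : R) : (x^-1)%:C = (x%:C)^-1.
Proof. exact: fmorphV. Qed.

Lemma realc_nat n : (n%:R : R)%:C = n%:R.
Proof. exact: rmorph_nat. Qed.

Lemma cexpD z w : cexp (z + w) = cexp z * cexp w.
Proof.
rewrite /cexp; case: z w => a b [c d] /=.
by rewrite expRD expiD rmorphM /=; ring.
Qed.

Lemma cexp0 : cexp (0 : C) = 1.
Proof. by rewrite /cexp /= expR0 expi0 mulr1. Qed.

Lemma cexp_neq0 z : cexp z != 0.
Proof.
by rewrite /cexp mulf_neq0 ?expi_neq0 // (fmorph_eq0 (real_complex R)) gt_eqF ?expR_gt0.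
Qed.

Lemma cexpN z : cexp (- z) = (cexp z)^-1.
Proof.
by apply: (mulfI (cexp_neq0 z)); rewrite -cexpD subrr cexp0 mulfV ?cexp_neq0.
Qed.

Lemma is_derive_le (f : R -> R) (x l : R) : is_derive x 1 f l ->
  forall e : R, 0 < e -> exists2 d : R, 0 < d &
    forall h, `|h| < d -> `|f (h + x) - f x - l * h| <= e * `|h|.
Proof.
move=> [df <-] e e0; set D := 'D_1 f x.
have dfl : (fun h => h^-1 *: (f (h *: 1 + x) - f x)) @ 0^' --> D by exact: df.
have /cvgrPdist_lt/(_ _ e0) := dfl.
move=> [d /= d0 Hd]; exists d => // h hd.
have [->|h0] := eqVneq h 0; first by rewrite add0r subrr mulr0 subrr normr0 mulr0.
have := Hd h; rewrite /ball_ /= sub0r normrN => /(_ hd h0) /ltW H.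
have -> : f (h + x) - f x - D * h = - (D - h^-1 *: (f (h *: 1 + x) - f x)) * h.
  by rewrite /GRing.scale /= mulr1; field.
by rewrite normrM normrN ler_wpM2r.
Qed.

Lemma cder_cexp0 : cder (@cexp R) 0 1.
Proof.
(* With w = x + iy, the error splits as (exp x - 1 - x) + (exp x - 1)(expi y - 1) + (expi y - 1 -
   iy). The three parts cost one, two and two fifths of [e * cmod w]. *)
apply/cderP => e e0; have e5 : 0 < e / 5 by rewrite divr_gt0.
have [d1 d10 H1] := is_derive_le (is_derive_expR (0 : R)) e5.
have [d2 d20 H2] := is_derive_le (is_derive_expR (0 : R)) ltr01.
have [d3 d30 H3] := is_derive_le (is_derive_sin (0 : R)) e5.
have [d4 d40 H4] := is_derive_le (is_derive_cos (0 : R)) e5.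
have [d5 d50 H5] := expi_cvg (0 : R) e5.
exists (Num.min d1 (Num.min d2 (Num.min d3 (Num.min d4 d5)))) => [|w].
  by rewrite !lt_min d10 d20 d30 d40.
rewrite subr0 !lt_min => /and5P[w1 w2 w3 w4 w5]; rewrite cexp0 mul1r.
have Rw := normRe_le w; have Iw := normIm_le w.
have := H1 _ (le_lt_trans Rw w1); rewrite addr0 expR0 mul1r.
have := H2 _ (le_lt_trans Rw w2); rewrite addr0 expR0 !mul1r.
have := H3 _ (le_lt_trans Iw w3); rewrite addr0 sin0 cos0 mul1r subr0.
have := H4 _ (le_lt_trans Iw w4); rewrite addr0 sin0 cos0 oppr0 mul0r subr0.
have := H5 (complex.Im w); rewrite subr0 expi0 => /(_ (le_lt_trans Iw w5)).
set x := complex.Re w in Rw *; set y := complex.Im w in Iw *.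
move=> hE hc hs h2 h1.
have -> : cexp w - 1 - w = (expR x - 1 - x)%:C + (expR x - 1)%:C * (expi y - 1) +
  (expi y - 1 - Complex 0 y).
  have {2}-> : w = x%:C + Complex 0 y by rewrite /x /y;
    case: w {hE hc hs h1 h2 w1 w2 w3 w4 w5 Rw Iw x y} => ? ?; apply/eqP;
    rewrite eq_complex /= add0r addr0 !eqxx.
  by rewrite /cexp -/x -/y !rmorphB rmorph1 /=; ring.
have hE' : cmod (expi y - 1 - Complex 0 y) <= e / 5 * `|y| + e / 5 * `|y|.
  by apply: (le_trans (cmod_le_ReIm _)); rewrite /= oppr0 !addr0; apply: lerD.
have h2' : `|expR x - 1| <= 2 * `|x|.
  by have := ler_normD (expR x - 1 - x) x; rewrite subrK; lra.
apply: (le_trans (cmodD _ _)); apply: (le_trans (lerD (cmodD _ _) (lexx _))).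
rewrite cmodM !cmodR.
have p : `|expR x - 1| * cmod (expi y - 1) <= 2 * `|x| * (e / 5) by apply: ler_pM => //;
  [exact: cmod_ge0|exact: ltW].
have q1 : e / 5 * `|x| <= e / 5 * cmod w by rewrite ler_wpM2l // ltW.
have q2 : e / 5 * `|y| <= e / 5 * cmod w by rewrite ler_wpM2l // ltW.
lra.
Qed.

Lemma cder_cexp z : cder (@cexp R) z (cexp z).
Proof.
have sh : cder (fun w => w - z) z 1 by rewrite -[X in cder _ _ X]subr0;
  exact (cderB (cder_id z) (cder_cst z z)).
have c0 : cder (@cexp R) (z - z) 1 by rewrite subrr; exact: cder_cexp0.
have := cderZ (cexp z) (cder_comp sh c0); rewrite !mulr1.
have -> // : (fun w => cexp z * cexp (w - z)) = @cexp R.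
by apply/funext => w; rewrite -cexpD addrC subrK.
Qed.

Lemma Re_cexp_gt0 w : strip w -> 0 < complex.Re (cexp w).
Proof.
move=> sw; have /cos_gt0_pihalf c0 : - (pi / 2) < complex.Im w < pi / 2.
  by rewrite -ltr_norml.
by rewrite /cexp ReZ mulr_gt0 ?expR_gt0.
Qed.

(** The principal logarithm on the right half plane; [x * s] is the modulus of [e]. *)
Lemma cexp_strip_surj e : 0 < complex.Re e -> exists2 w, strip w & cexp w = e.
Proof.
case: e => x y /= x0; pose t := y / x; pose s := Num.sqrt (1 + t ^+ 2).
have s2 : 0 < 1 + t ^+ 2 by rewrite ltr_pwDl // sqr_ge0.
have s0 : 0 < s by rewrite sqrtr_gt0.
exists (Complex (ln (x * s)) (atan t)).
  by rewrite /strip /= ltr_norml atan_gtNpi2 atan_ltpi2.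
have cE : cos (atan t) = s^-1 by rewrite cos_atan.
have sE : sin (atan t) = t / s.
  by have := atanK t; rewrite /tan cE invrK => {2}<-; rewrite mulfK // gt_eqF.
rewrite /cexp /= lnK ?posrE ?mulr_gt0 // /expi cE sE.
apply/eqP; rewrite eq_complex /= !mul0r subr0 addr0; apply/andP; split; apply/eqP.
  by rewrite mulfK // gt_eqF.
by rewrite /t; field; rewrite !gt_eqF.
Qed.

Lemma cder_gmap w : cder (@gmap R) w (1 + ccosh w).
Proof.
rewrite /ccosh; apply: cderD; first exact: cder_id.
have E1 := cder_cexp w.
have E2 : cder (fun w : C => cexp (- w)) w (- cexp (- w)).
  have N : cder (fun w : C => - w) w (-1) by exact (cderN (cder_id w)).
  by rewrite -mulrN1; exact (cder_comp N (cder_cexp (- w))).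
have := cderM (cderB E1 E2) (cder_cst 2^-1 w).
by rewrite mulr0 addr0 opprK.
Qed.

End ComplexExponential.

Section StripModel.
Variable R : realType.
Local Notation C := R[i].
Implicit Types (z w e : C).
Variables (a b : C) (tau : R).
Hypotheses (a1 : cmod a = 1) (b1 : cmod b = 1) (ab : a != b) (tau0 : 0 < tau).

(** In [half_plane_to_disk] infinity goes to [a] and 0 to [b] for any nonzero [lam]. The argument of
    (b-a)/b is the one that matches the disk with the right half plane; [tau] is the remaining
    dilation of the half plane. *)
Definition strip_lambda : C := tau%:C * (b - a) / b.
Local Notation lam := strip_lambda.
Definition half_plane_to_disk e : C := (a * e + b * lam) / (e + lam).
Definition disk_to_half_plane z : C := lam * (b - z) / (z - a).

Let ane0 : a != 0. Proof. exact: circle_neq0. Qed.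
Let bne0 : b != 0. Proof. exact: circle_neq0. Qed.
Let abne0 : a - b != 0. Proof. by rewrite subr_eq0. Qed.
Let bane0 : b - a != 0. Proof. by rewrite subr_eq0 eq_sym. Qed.
Let tauC0 : tau%:C != 0. Proof. by rewrite (fmorph_eq0 (real_complex R)) gt_eqF. Qed.

Lemma strip_lambda_neq0 : lam != 0.
Proof. by rewrite /lam !mulf_neq0 // invr_eq0. Qed.

Lemma sqr_dist_circle : (cmod (a - b) ^+ 2)%:C = - (a - b) ^+ 2 / (a * b).
Proof.
by rewrite sqr_cmodC conjcB !conjc_circle //; field; rewrite ane0 bne0.
Qed.

(** In the half plane coordinate e, the kernel functions of [a] and [b] are positive multiples of e
    and 1/e, up to opposite imaginary constants. With e = exp w they combine to a cosh once [tau]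
    equates the two coefficients. *)
Lemma kernel_a_half_plane z : z != a -> (a + z) / (a - z) =
  (2 / (tau * cmod (a - b) ^+ 2))%:C * disk_to_half_plane z + (a + b) / (a - b).
Proof.
move=> za; have := sqr_dist_circle; move: (cmod (a - b) ^+ 2) => D DE.
rewrite !(realcM, realcV, realc_nat) DE /disk_to_half_plane /lam.
field; rewrite ane0 bne0 tauC0 abne0 !subr_eq0 za /= eq_sym za //.
Qed.

Lemma kernel_b_half_plane z : z != a -> z != b -> (b + z) / (b - z) =
  (2 * tau)%:C / disk_to_half_plane z - (a + b) / (a - b).
Proof.
move=> za zb; rewrite realcM realc_nat /disk_to_half_plane /lam.
field; rewrite bne0 tauC0 abne0 bane0 !subr_eq0 za /= eq_sym zb //.
Qed.

Lemma Re_disk_to_half_plane z : z != a -> complex.Re (disk_to_half_plane z) =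
  tau * cmod (a - b) ^+ 2 / 2 * poisson_kernel z a.
Proof.
move=> za; rewrite /poisson_kernel kernel_a_half_plane // ReD ReZ.
have -> : complex.Re ((a + b) / (a - b)) = 0 := poisson_kernel_circle b1 a1 ab.
have cd0 : cmod (a - b) != 0 by rewrite cmod_eq0.
by rewrite addr0; field; rewrite cd0 gt_eqF.
Qed.

Lemma Re_disk_to_half_plane_gt0 z : cmod z < 1 -> 0 < complex.Re (disk_to_half_plane z).
Proof.
move=> z1; have za : z != a := circle_disk_neq a1 z1.
have d0 : 0 < cmod (a - b) by rewrite cmod_gt0.
rewrite Re_disk_to_half_plane // poisson_kernelE //; last by rewrite eq_sym.
apply: mulr_gt0; first by rewrite !mulr_gt0 // exprn_gt0.
rewrite divr_gt0 ?exprn_gt0 ?cmod_gt0 ?subr_eq0 1?eq_sym //.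
by rewrite subr_gt0 expr_lt1 ?cmod_ge0.
Qed.

Lemma half_plane_denom_neq0 e : 0 < complex.Re e -> e + lam != 0.
Proof.
move=> e0; apply/eqP => E; have := congr1 (@complex.Re R) E; rewrite ReD /=.
have : 0 <= complex.Re lam.
  have -> : lam = tau%:C * (1 - a / b) by rewrite /lam; field.
  rewrite ReZ mulr_ge0 ?(ltW tau0) // ReB /= subr_ge0.
  by apply: (le_trans (ler_norm _)); apply: (le_trans (normRe_le _));
    rewrite cmodM cmodV a1 b1 divr1.
lra.
Qed.

Lemma half_plane_to_diskK e : 0 < complex.Re e ->
  disk_to_half_plane (half_plane_to_disk e) = e.
Proof.
move=> /half_plane_denom_neq0 el; have l0 := strip_lambda_neq0.
rewrite /disk_to_half_plane /half_plane_to_disk.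
have -> : b - (a * e + b * lam) / (e + lam) = (b - a) * e / (e + lam) by field.
have -> : (a * e + b * lam) / (e + lam) - a = (b - a) * lam / (e + lam) by field.
by field; rewrite el l0 bane0.
Qed.

Lemma disk_to_half_planeK z : cmod z < 1 -> half_plane_to_disk (disk_to_half_plane z) = z.
Proof.
move=> z1; have za : z - a != 0.
  by rewrite subr_eq0 circle_disk_neq.
rewrite /half_plane_to_disk /disk_to_half_plane; have l0 := strip_lambda_neq0.
have -> : lam * (b - z) / (z - a) + lam = lam * (b - a) / (z - a) by field.
have -> : a * (lam * (b - z) / (z - a)) + b * lam = z * (lam * (b - a)) / (z - a) by field.
by field; rewrite za l0 bane0.
Qed.

Lemma half_plane_to_disk_neq e : 0 < complex.Re e -> half_plane_to_disk e != a.
Proof.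
move=> e0; have el := half_plane_denom_neq0 e0; have l0 := strip_lambda_neq0.
rewrite -subr_eq0 /half_plane_to_disk.
have -> : (a * e + b * lam) / (e + lam) - a = (b - a) * lam / (e + lam) by field.
by rewrite !mulf_neq0 // invr_eq0.
Qed.

Lemma cmod_half_plane_to_disk e : 0 < complex.Re e -> cmod (half_plane_to_disk e) < 1.
Proof.
move=> e0; have za := half_plane_to_disk_neq e0.
have := Re_disk_to_half_plane za; rewrite half_plane_to_diskK // => E.
have d0 : 0 < cmod (a - b) by rewrite cmod_gt0.
have : 0 < poisson_kernel (half_plane_to_disk e) a.
  move: e0; rewrite E pmulr_rgt0 // !mulr_gt0 // exprn_gt0 //.
rewrite poisson_kernelE // 1?eq_sym // pmulr_lgt0 ?invr_gt0 ?exprn_gt0 ?cmod_gt0 ?subr_eq0 1?eq_sym //.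
by rewrite subr_gt0 expr_lt1 ?cmod_ge0.
Qed.

Lemma cder_half_plane_to_disk e : 0 < complex.Re e ->
  cder half_plane_to_disk e (lam * (a - b) / (e + lam) ^+ 2).
Proof.
move=> e0; have el := half_plane_denom_neq0 e0.
have N : cder (fun e => a * e + b * lam) e (a * 1 + 0)
  by exact (cderD (cderZ a (cder_id e)) (cder_cst (b * lam) e)).
have D : cder (fun e => e + lam) e (1 + 0) by exact (cderD (cder_id e) (cder_cst lam e)).
have := @cder_div _ _ _ e _ _ el N D.
suff -> : ((a * 1 + 0) * (e + lam) - (a * e + b * lam) * (1 + 0)) = lam * (a - b) by [].
by ring.
Qed.

(* The zero of the derivative of [h] sits at the image of [-1]; the factor is
   kept in this homogeneous form because that image may be infinity. *)
Definition strip_factor : {poly C} := (lam - 1) *: 'X - (b * lam - a)%:P.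

Lemma strip_factorE z : strip_factor.[z] = (lam - 1) * z - (b * lam - a).
Proof. by rewrite /strip_factor hornerD hornerN hornerZ hornerX hornerC. Qed.

(** With z = mu(e) and e = exp w, the given derivative times dz/dw reduces to k lam/(a-b) (e+1)^2/e,
    that is [A * (1 + ccosh w)], the derivative of [A * gmap w]. The difference is constant because
    the strip is star-shaped about 0. *)
Lemma strip_conformal (h : C -> C) (k : C) :
  (forall z, cmod z < 1 -> cder h z (k * strip_factor.[z] ^+ 2 / ((z - a) ^+ 2 * (z -
    b) ^+ 2))) ->
  forall w, strip w -> h (half_plane_to_disk (cexp w)) =
    2 * k * lam / (a - b) * gmap w +
      (h (half_plane_to_disk 1) - 2 * k * lam / (a - b) * gmap 0).
Proof.
move=> dh w sw; set A := 2 * k * lam / (a - b).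
have l0 := strip_lambda_neq0.
have dH x : strip x -> cder (fun x => h (half_plane_to_disk (cexp x)) - A * gmap x) x 0.
  move=> sx; have e0 := Re_cexp_gt0 sx; have el := half_plane_denom_neq0 e0.
  have z1 := cmod_half_plane_to_disk e0.
  have d1 := cder_comp (cder_cexp x) (cder_half_plane_to_disk e0).
  have := cderB (@cder_comp _ _ _ _ _ _ d1 (dh _ z1)) (cderZ A (cder_gmap x)).
  set l := (l in cder _ _ l -> _); suff -> : l = 0 by [].
  rewrite /l strip_factorE /A /ccosh cexpN; have := cexp_neq0 x.
  move: (cexp x) el {e0 z1 d1 l} => e el e0.
  have -> : (lam - 1) * half_plane_to_disk e - (b * lam - a) = - (e +
    1) * ((b - a) * lam / (e + lam)).
    by rewrite /half_plane_to_disk; field.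
  have -> : half_plane_to_disk e - a = (b - a) * lam / (e + lam).
    by rewrite /half_plane_to_disk; field.
  have -> : half_plane_to_disk e - b = (a - b) * e / (e + lam).
    by rewrite /half_plane_to_disk; field.
  by field; rewrite el e0 l0 abne0 bane0.
have s0 : strip (0 : C) by rewrite /strip /= normr0 divr_gt0 // pi_gt0.
have := @cder0_segment _ (fun x => h (half_plane_to_disk (cexp x)) - A * gmap x) 0 w.
rewrite cexp0 => E; rewrite -E; first by ring.
move=> s s01; apply: dH; rewrite add0r subr0 /strip /=.
move: sw; rewrite /strip; case: w {E} => x y /=; rewrite mul0r addr0 normrM.
case/andP: s01 => s0' s1; rewrite (ger0_norm s0'); apply: le_lt_trans.
by rewrite ler_piMl.
Qed.

End StripModel.

(** * Real derivatives of the real part, and passage from almost every circle point to all *)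

Section DirectionalDerivatives.
Variable R : realType.
Local Notation C := R[i].
Implicit Types (z w e : C) (u v : C -> R).

Lemma dir_derivE u v z l n : cder (fun z => Complex (u z) (v z)) z l ->
  dir_deriv u z n = complex.Re (l * n).
Proof.
move=> fl; rewrite /dir_deriv derive1E.
have fl0 : cder (fun z => Complex (u z) (v z)) (z + (0 : R)%:C * n) l.
  by rewrite rmorph0 mul0r addr0.
by have [_ <-] := is_derive_Re_line fl0.
Qed.

Lemma pdxE u v z l : cder (fun z => Complex (u z) (v z)) z l -> pdx u z = complex.Re l.
Proof.
move=> fl; have := dir_derivE 1 fl; rewrite mulr1 => <-.
by rewrite /pdx /dir_deriv; under [in RHS]eq_fun do rewrite mulr1.
Qed.

Lemma pdyE u v z l : cder (fun z => Complex (u z) (v z)) z l -> pdy u z = - complex.Im l.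
Proof.
move=> fl; have := dir_derivE (Complex 0 1) fl; rewrite /pdy /dir_deriv.
have -> : (fun s : R => u (z + s%:C * Complex 0 1)) = (fun t => u (z + Complex 0 t)).
  apply/funext => t; congr (u (z + _)); apply/eqP; rewrite eq_complex /=.
  by rewrite !(mulr0, mul0r, subr0, mulr1, addr0, add0r, oppr0) !eqxx.
move=> ->; case: l {fl} => x y /=; ring.
Qed.

Lemma continuous_radial (Y : C -> R) e : cmod e = 1 -> {for e, continuous Y} ->
  Y (r%:C * e) @[r --> at_left 1] --> Y e.
Proof.
move=> e1 /continuousRP cY; apply/cvgrPdist_lt => eps eps0.
have [d d0 Hd] := cY _ eps0; exists d => //= r; rewrite /= => hr r1.
rewrite distrC; apply: Hd; have ->
  : r%:C * e - e = (r - 1)%:C * e by rewrite rmorphB rmorph1; ring.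
by rewrite cmodM e1 mulr1 cmodR distrC.
Qed.

Lemma at_left1_lt (P : R -> Prop) : (forall r, 0 < r < 1 -> P r) ->
  \forall r \near at_left (1 : R), P r.
Proof.
move=> H; exists 1 => //= r /=; rewrite ltr_norml => /andP[h1 h2] r1; apply: H.
by rewrite r1 andbT; lra.
Qed.

(** If Y were positive at a non-root of [q], then near it [q] would stay nonzero and Y positive, and
    this neighbourhood contains points of [P]. The polynomial [q] removes the poles, where the
    inequality is not known. *)
Lemma circle_density (P : R -> Prop) (q : {poly C}) (Y : C -> R) (t : R) : ae_circle P ->
  (forall s, P s -> q.[expi s] != 0 -> Y (expi s) <= 0) ->
  {for expi t, continuous Y} -> q.[expi t] != 0 -> Y (expi t) <= 0.
Proof.
move=> aeP H /continuousRP cY qt; rewrite leNgt; apply/negP => Yt.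
have [d1 d10 H1] := cY _ Yt.
have qt0 : 0 < cmod q.[expi t] by rewrite cmod_gt0.
have [d2 d20 H2] := iffLR (continuousCP _ _) (cder_continuous (cder_poly q (expi t))) _ qt0.
have m0 : 0 < Num.min d1 d2 by rewrite lt_min d10.
have [d d0 Hd] := expi_cvg t m0.
have [s /Hd] := ae_circle_dense aeP t d0.
rewrite lt_min => /andP[/H1 Y1 /H2 q1] Ps.
have qs : q.[expi s] != 0.
  by apply/eqP => E; move: q1; rewrite E sub0r cmodN ltxx.
by have := H s Ps qs; move: Y1; rewrite ltr_norml => /andP[h _]; lra.
Qed.

Lemma ae_circleI (P Q : R -> Prop) : ae_circle P -> ae_circle Q ->
  ae_circle (fun t => P t /\ Q t).
Proof. by move=> hP hQ; have := negligibleU hP hQ; rewrite -setCI. Qed.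

Lemma circle_nonroot (q : {poly C}) : q != 0 -> exists t : R, q.[expi t] != 0.
Proof.
move=> q0; apply: contrapT => H; move/eqP: q0; apply; apply: poly_circle_eq0 => t.
by apply/eqP; apply: contrapT => /negP qt; apply: H; exists t.
Qed.

End DirectionalDerivatives.

(** * Polynomial identities on the circle for the weights and the factor L *)

Section BoundaryIdentities.
Variable R : realType.
Local Notation C := R[i].
Implicit Types (z w e : C).

(** Rules out a zero weight at [a]; exchanging [a] and [b] rules out the other. By
    [proportional_modulus] and cancellation of (z-a)^2, P (z-b)^2 is a multiple of Q. As Q(a) = 0,
    this gives P(a) = 0, against coprimality. *)
Lemma atom_positive (P Q : {poly C}) (a b : C) (beta kappa : R) :
  coprimep P Q -> root Q a -> a != b -> P != 0 -> cmod a = 1 -> cmod b = 1 ->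
  (forall z, cmod z < 1 -> P.[z] != 0) -> (forall z, cmod z < 1 -> Q.[z] != 0) ->
  0 < kappa -> 0 <= beta ->
  (forall t, kappa * (cmod P.[expi t] * cmod (expi t - a) ^+ 2 * cmod (expi t - b) ^+ 2) =
     2 * (beta * cmod (expi t - a) ^+ 2) * cmod Q.[expi t]) -> False.
Proof.
move=> cop Qa ab P0 a1 b1 PD QD k0; rewrite le_eqVlt => beta0 H.
have nz c z : cmod c = 1 -> cmod z < 1 -> ('X - c%:P).[z] != 0.
  by move=> c1 z1; rewrite hornerXsubC subr_eq0 circle_disk_neq.
pose A := P * ('X - a%:P) ^+ 2 * ('X - b%:P) ^+ 2; pose B := Q * ('X - a%:P) ^+ 2.
have Xa0 : ('X - a%:P) ^+ 2 != 0 by rewrite expf_neq0 // polyXsubC_eq0.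
have A0 : A != 0 by rewrite /A !mulf_neq0 // polyXsubC_eq0.
have AE t : cmod A.[expi t] = cmod P.[expi t] * cmod (expi t - a) ^+ 2 * cmod (expi t -
  b) ^+ 2.
  by rewrite /A hornerM hornerM !horner_exp !hornerXsubC cmodM cmodM !cmodX.
have BE t : cmod B.[expi t] = cmod Q.[expi t] * cmod (expi t - a) ^+ 2.
  by rewrite /B hornerM !horner_exp !hornerXsubC cmodM !cmodX.
case/orP: beta0 => [/eqP beta0|beta0].
  have [t] := circle_nonroot A0; rewrite -cmod_eq0 AE => /eqP; apply.
  by apply: (mulfI (lt0r_neq0 k0)); rewrite H -beta0 !(mul0r, mulr0).
have kb : 2 * beta / kappa != 0 by rewrite !mulf_neq0 ?invr_eq0 ?pnatr_eq0 ?gt_eqF.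
have [||t|c c0 E] := @proportional_modulus R A B (2 * beta / kappa) A0 kb.
- by move=> z z1; rewrite /A !hornerM !mulf_neq0 ?PD ?nz.
- by move=> z z1; rewrite /B !hornerM !mulf_neq0 ?QD ?nz.
- rewrite AE BE; apply: (mulfI (lt0r_neq0 k0)); rewrite H; field; exact: lt0r_neq0.
have E' : P * ('X - b%:P) ^+ 2 = c *: Q.
  by apply: (mulIf Xa0); rewrite -scalerAl -E /A mulrAC.
have := congr1 (horner^~ a) E'; rewrite hornerM horner_exp hornerXsubC hornerZ (eqP Qa) mulr0.
move/eqP; rewrite mulf_eq0 expf_eq0 subr_eq0 (negbTE ab) andbF orbF => Pa.
have := coprimep_root cop Pa; by rewrite (eqP Qa) eqxx.
Qed.

(** The factor is -(y+1)(z-a) with y the half plane coordinate of z. On the circle y is imaginary,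
    so |y+1|^2 = 1 + |y|^2 and no cross term remains. *)
Lemma strip_factor_circle (a b e : C) (tau : R) : cmod a = 1 -> cmod b = 1 -> cmod e = 1 ->
  cmod (strip_factor a b tau).[e] ^+ 2 =
  cmod (e - a) ^+ 2 + tau ^+ 2 * cmod (a - b) ^+ 2 * cmod (e - b) ^+ 2.
Proof.
move=> a1 b1 e1.
have [a0 b0 e0] := And3 (circle_neq0 a1) (circle_neq0 b1) (circle_neq0 e1).
apply: complexI; rewrite rmorphD sqr_cmodC.
rewrite [X in _ = X + _]/= [X in _ = _ + X]rmorphM [X in _ = _ + X * _]rmorphM /=.
rewrite !sqr_cmodC rmorphXn /= strip_factorE /strip_lambda.
rewrite !(conjcB, conjcM, conjc_inv, conjc_real, conjc1) !conjc_circle //.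
by field; rewrite a0 b0 e0.
Qed.

Lemma strip_factor_disk (a b z : C) (tau : R) : cmod a = 1 -> cmod b = 1 -> a != b ->
  0 < tau ->
  cmod z < 1 -> (strip_factor a b tau).[z] != 0.
Proof.
move=> a1 b1 ab tau0 z1; have := Re_disk_to_half_plane_gt0 a1 b1 ab tau0 z1.
have za : z - a != 0 by rewrite subr_eq0 circle_disk_neq.
have -> : (strip_factor a b tau).[z] = - (disk_to_half_plane a b tau z + 1) * (z - a).
  by rewrite strip_factorE /disk_to_half_plane; field.
move=> E0; rewrite mulf_neq0 // oppr_eq0; apply/eqP => E.
by have := congr1 (@complex.Re R) E; rewrite ReD /=; lra.
Qed.

(** The function (a+z)/(a-z) is imaginary on the circle, hence so is its tangential derivative, and
    its radial derivative is real. *)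
Lemma kernel_derivative_circle (a e : C) : cmod a = 1 -> cmod e = 1 -> e != a ->
  2 * a / (a - e) ^+ 2 * e = - (2 / cmod (e - a) ^+ 2)%:C.
Proof.
move=> a1 e1 ea.
have [a0 e0] := conj (circle_neq0 a1) (circle_neq0 e1).
have ae : a - e != 0 by rewrite subr_eq0 eq_sym.
rewrite realcM realcV cmodB sqr_dist_circle // realc_nat.
by field; rewrite a0 e0 ae.
Qed.

Lemma cder_kernel (a z : C) : cmod a = 1 -> z != a ->
  cder (fun z => (a + z) / (a - z)) z (2 * a / (a - z) ^+ 2).
Proof.
move=> a1 za; have az : a - z != 0 by rewrite subr_eq0 eq_sym.
have N : cder (fun z => a + z) z (0 + 1) by exact (cderD (cder_cst a z) (cder_id z)).
have D : cder (fun z => a - z) z (0 - 1) by exact (cderB (cder_cst a z) (cder_id z)).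
have := @cder_div _ (fun z => a + z) (fun z => a - z) z _ _ az N D.
suff -> : (0 + 1) * (a - z) - (a + z) * (0 - 1) = 2 * a by [].
by ring.
Qed.

End BoundaryIdentities.

(** * Roof functions *)

Section RoofFunction.
Variable R : realType.
Local Notation C := R[i].
Implicit Types (z w e : C).
Variables (Om : set C) (h : C -> C) (u v : C -> R) (P Q : {poly C}) (a b : C) (c : R).
Let f z := Complex (u z) (v z).
Let F z := f (h z).
(** The quotient of [P] and [Q], unlike [derive1 h], is also meaningful on the circle, where its
    continuity is used. *)
Let dF z := derive1 f (h z) * (P.[z] / Q.[z]).
Hypotheses (hD : forall z, cmod z < 1 -> cder h z (P.[z] / Q.[z]))
  (h'E : forall z, cmod z < 1 -> derive1 h z = P.[z] / Q.[z])
  (PD : forall z, cmod z < 1 -> P.[z] != 0) (QD : forall z, cmod z < 1 -> Q.[z] != 0)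
  (hOm : forall z, cmod z < 1 -> Om (h z)) (oOm : open Om)
  (fD : forall z, Om z -> cder f z (derive1 f z))
  (ux : forall z, Om z -> {for z, continuous (pdx u)})
  (uy : forall z, Om z -> {for z, continuous (pdy u)})
  (u0 : forall z, Om z -> 0 < u z)
  (ubd : ae_circle (fun t => boundary_value h u t 0 /\ normal_derivative h u t c))
  (c0 : c != 0) (copPQ : coprimep P Q) (P0 : P != 0) (Q0 : Q != 0)
  (ab : a != b) (a1 : cmod a = 1) (b1 : cmod b = 1) (Qa : root Q a) (Qb : root Q b)
  (Qab : forall z, cmod z = 1 -> root Q z -> z = a \/ z = b).

(** By the Cauchy-Riemann equations f' = u_x - i u_y, so f' inherits its continuity from the partial
    derivatives of [u]. *)
Lemma roof_holo : holo_disk 1 F dF.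
Proof.
move=> z z1; split; first exact: cder_comp (hD z1) (fD (hOm z1)).
have cf' : {for h z, continuous (derive1 f)}.
  apply/continuousCP => e e0; have e2 : 0 < e / 2 by rewrite divr_gt0.
  have [d1 d10 H1] := iffLR (continuousRP _ _) (ux (hOm z1)) _ e2.
  have [d2 d20 H2] := iffLR (continuousRP _ _) (uy (hOm z1)) _ e2.
  have [d3 d30 H3] := openC_ball oOm (hOm z1).
  exists (Num.min d1 (Num.min d2 d3)) => [|w]; first by rewrite !lt_min d10 d20.
  rewrite !lt_min => /and3P[/H1 h1 /H2 h2 /H3 Ow].
  move: h1 h2; rewrite (pdxE (fD Ow)) (pdyE (fD Ow)) (pdxE (fD (hOm z1))) (pdyE (fD (hOm z1))).
  rewrite -ReB opprK => h1 h2; apply: (le_lt_trans (cmod_le_ReIm _)).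
  by rewrite [e]splitr; apply: ltrD => //; rewrite ImB distrC addrC.
have cPQ : {for z, continuous (fun z => P.[z] / Q.[z])}.
  exact (cder_continuous (@cder_div _ (horner P) (horner Q) z _ _ (QD z1) (cder_poly P z)
    (cder_poly Q z))).
exact (ccontM (ccont_comp (cder_continuous (hD z1)) cf') cPQ).
Qed.

Lemma roof_ge0 z : cmod z < 1 -> 0 <= complex.Re (F z).
Proof. by move=> z1; apply/ltW/u0/hOm. Qed.

Lemma cmod_radius (t r : R) : 0 <= r < 1 -> cmod (r%:C * expi t) < 1.
Proof. by move=> /andP[r0 r1]; rewrite cmodM cmod_expi mulr1 cmodR ger0_norm. Qed.

(** The normal derivative is taken along a unit vector; multiplied by |h'| it is the radial
    derivative of Re F, and |h'| has a limit at a point that is not a pole. *)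
Lemma roof_radial_derivative t : normal_derivative h u t c -> Q.[expi t] != 0 ->
  complex.Re (dF (r%:C * expi t) * expi t) @[r --> at_left 1] --> c * cmod
    (P.[expi t] / Q.[expi t]).
Proof.
move=> nd Qt.
have cPQ : {for expi t, continuous (fun z => cmod (P.[z] / Q.[z]))}.
  have cPQ := cder_continuous (@cder_div _ (horner P) (horner Q) _ _ _ Qt (cder_poly P
    (expi t)) (cder_poly Q (expi t))).
  exact (continuous_comp cPQ (@continuous_cmod R _)).
have FF : Filter (at_left (1 : R)) by exact: at_left_proper_filter.
have lim := cvgM nd (continuous_radial (cmod_expi t) cPQ); refine (cvg_trans _ (lim FF));
  apply: near_eq_cvg; near=> r.
have /andP[r0 r1] : 0 < r < 1 by near: r; apply: at_left1_lt.
have z1 : cmod (r%:C * expi t) < 1 by apply: cmod_radius; rewrite ltW.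
rewrite /= /GRing.mul_fun /= (dir_derivE _ (fD (hOm z1))) h'E //.
set m := cmod _; have m0 : m != 0.
  by rewrite /m cmod_eq0 mulf_neq0 ?invr_eq0 ?PD ?QD.
rewrite [LHS]mulrC -ReZ /dF; congr complex.Re.
have mC : m%:C != 0 by rewrite (fmorph_eq0 (real_complex R)).
move: (P.[_] / _) => x; field; exact: mC.
Unshelve. all: by end_near. Qed.

Lemma roof_boundary_bound0 t : boundary_value h u t 0 /\ normal_derivative h u t c ->
  Q.[expi t] != 0 ->
  c * cmod (P.[expi t] / Q.[expi t]) <= 0 /\ forall r : R, 0 <= r < 1 ->
    complex.Re (F (r%:C * expi t)) * (1 +
      r) <= 2 * (- (c * cmod (P.[expi t] / Q.[expi t]))) * (1 - r).
Proof.
move=> [bv nd] Qt.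
exact: (radial_boundary_bound roof_holo roof_ge0 (cmod_expi t) bv
  (roof_radial_derivative nd Qt)).
Qed.

(** By [roof_boundary_bound0], c |P| <= 0 at almost every point that is not a pole, hence by density
    at a point where neither [P] nor [Q] vanishes. *)
Lemma roof_normal_lt0 : c < 0.
Proof.
have [t] := circle_nonroot (mulf_neq0 P0 Q0); rewrite hornerM mulf_eq0 negb_or => /andP[Pt Qt].
rewrite lt_def eq_sym c0 /= leNgt; apply/negP => c_gt0.
have cY : {for expi t, continuous (fun z => c * cmod P.[z])}.
  apply: (@continuousM R C (fun=> c) (fun z => cmod P.[z])); first exact: cst_continuous.
  exact (continuous_comp (cder_continuous (cder_poly P (expi t))) (@continuous_cmod R _)).
suff : c * cmod P.[expi t] <= 0 by rewrite pmulr_rle0 // leNgt cmod_gt0 Pt.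
apply: (@circle_density R _ Q (fun z => c * cmod P.[z]) t ubd _ cY Qt) => s hs Qs.
have [+ _] := roof_boundary_bound0 hs Qs;
  by rewrite cmodM cmodV mulrA pmulr_lle0 // invr_gt0 cmod_gt0.
Qed.

(** Multiplying by |Q| makes both sides continuous on the circle for fixed [r], so the bound holds
    at every point, the poles included. *)
Lemma roof_boundary_bound (t r : R) : 0 <= r < 1 ->
  complex.Re (F (r%:C * expi t)) * (1 +
    r) * cmod Q.[expi t] <= 2 * (- c) * cmod P.[expi t] * (1 - r).
Proof.
move=> r01; have /andP[r0 r1] := r01.
have [Qt|Qt] := eqVneq Q.[expi t] 0.
  rewrite Qt cmod0 mulr0 !mulr_ge0 ?cmod_ge0 //; last by lra.
  by rewrite oppr_ge0 ltW ?roof_normal_lt0.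
rewrite -subr_le0.
pose Y e := complex.Re (F (r%:C * e)) * (1 +
  r) * cmod Q.[e] - 2 * (- c) * cmod P.[e] * (1 - r).
apply: (@circle_density R _ Q Y t ubd) => // [s hs Qs|].
  have [_ /(_ r r01)] := roof_boundary_bound0 hs Qs; rewrite cmodM cmodV /Y subr_le0 => H.
  have qs : 0 < cmod Q.[expi s] by rewrite cmod_gt0.
  rewrite -ler_pdivlMr //; apply: (le_trans H); rewrite le_eqVlt; apply/orP; left;
    apply/eqP; ring.
have z1 := cmod_radius t r01.
have lin : cder (fun e : C => r%:C * e) (expi t) r%:C.
  by rewrite -[X in cder _ _ X]mulr1; exact (cderZ _ (cder_id (expi t))).
have cF : {for expi t, continuous (fun e => complex.Re (F (r%:C * e)))}.
  exact (continuous_comp (cder_continuous (cder_comp lin (roof_holo z1).1))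
    (@continuous_Re R _)).
have cP (p : {poly C}) : {for expi t, continuous (fun e => cmod p.[e])}.
  exact (continuous_comp (cder_continuous (cder_poly p (expi t))) (@continuous_cmod R _)).
have ck (k : R) : {for expi t, continuous (fun e : C => k)} by exact: cst_continuous.
exact (continuousB (continuousM (continuousM cF (ck (1 + r))) (cP Q))
  (continuousM (continuousM (ck (2 * - c)) (cP P)) (ck (1 - r)))).
Qed.

(** |Q| is bounded below there: the roots of [Q] on the circle are [a] and [b], and any other root r
    stays at distance |1 - |r|| from the circle. *)
Lemma roof_away (eps : R) : 0 < eps -> exists2 K : R, 0 <= K &
  forall (t r : R), eps <= cmod (expi t - a) -> eps <= cmod (expi t - b) -> 0 <= r < 1 ->
    complex.Re (F (r%:C * expi t)) <= K * (1 - r).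
Proof.
move=> eps0; have [Kp Kp0 HP] := poly_upper_bound P.
have [|cq cq0 HQ] := @poly_lower_bound R Q
    (fun e => [/\ cmod e = 1, eps <= cmod (e - a) & eps <= cmod (e - b)]) Q0.
  move=> r rQ; have [r1|r1] := eqVneq (cmod r) 1.
    by exists eps => // e [_ ea eb]; have [->|->] := Qab r1 rQ.
  exists `|1 - cmod r| => [|e [<- _ _]]; last exact: cmod_distB.
  by rewrite normr_gt0 subr_eq0 eq_sym.
have k0 : 0 <= 2 * - c by rewrite mulr_ge0 // oppr_ge0 ltW // roof_normal_lt0.
exists (2 * - c * Kp / cq) => [|t r ea eb r01]; first by apply: divr_ge0;
  [exact: mulr_ge0|exact: ltW].
have /andP[r0 r1] := r01; have z1 := cmod_radius t r01.
have U0 := roof_ge0 z1; set U := complex.Re _ in U0 *.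
have := roof_boundary_bound t r01; rewrite -/U => B.
have q := HQ (expi t) (And3 (cmod_expi t) ea eb);
  have p := HP (expi t) ltac:(by rewrite cmod_expi).
rewrite mulrAC ler_pdivlMr //.
apply: (@le_trans _ _ (U * (1 + r) * cmod Q.[expi t])).
  apply: ler_pM => //; first exact: ltW.
  by rewrite ler_peMr // lerDl.
apply: (le_trans B); apply: ler_wpM2r; first by lra.
exact: ler_wpM2l.
Qed.

(** [two_atoms] gives the real part. The difference F - S has real part 0, hence derivative 0, hence
    is the imaginary constant it equals at 0. *)
Lemma roof_kernels : exists alpha beta gamma : R, [/\ 0 <= alpha, 0 <= beta,
  forall z, cmod z < 1 -> F z = alpha%:C * ((a + z) / (a - z)) + beta%:C * ((b +
    z) / (b - z)) + Complex 0 gamma &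
  forall z, cmod z < 1 -> dF z = alpha%:C * (2 * a / (a - z) ^+ 2) +
    beta%:C * (2 * b / (b - z) ^+ 2)].
Proof.
have [alpha [beta [al0 be0 H]]] := two_atoms roof_holo roof_ge0 a1 b1 ab roof_away.
pose S z : C := alpha%:C * ((a + z) / (a - z)) + beta%:C * ((b + z) / (b - z)).
pose dS z : C := alpha%:C * (2 * a / (a - z) ^+ 2) + beta%:C * (2 * b / (b - z) ^+ 2).
have cS z : cmod z < 1 -> cder S z (dS z).
  move=> z1; exact (cderD (cderZ alpha%:C (cder_kernel a1 (circle_disk_neq a1 z1)))
                          (cderZ beta%:C (cder_kernel b1 (circle_disk_neq b1 z1)))).
have ReFS z : cmod z < 1 -> complex.Re (F z - S z) = 0.
  by move=> z1; rewrite ReB H // /S ReD !ReZ subrr.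
have dFS z : cmod z < 1 -> dF z = dS z.
  move=> z1; apply/eqP; rewrite -subr_eq0; apply/eqP.
  have zz : 0 < 1 - cmod z by rewrite subr_gt0.
  apply: (@cder_Re_eq0 _ (fun z => F z - S z) z _ (1 - cmod z)) => //.
    move=> w wz; apply: ReFS; have := cmodD (w - z) z; rewrite subrK; lra.
  exact (cderB (roof_holo z1).1 (cS z z1)).
exists alpha, beta, (complex.Im (F 0 - S 0)); split=> // z z1.
have c00 : cmod (0 : C) < 1 by rewrite cmod0.
have E : F z - S z = F 0 - S 0.
  apply: (@cder0_segment _ (fun z => F z - S z)) => s s01.
  have w1 : cmod (0 + s%:C * (z - 0)) < 1.
    have /andP[s0 s1] := s01; rewrite add0r subr0 cmodM cmodR ger0_norm //.
    by apply: le_lt_trans z1; rewrite ler_piMl ?cmod_ge0.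
  by have := cderB (roof_holo w1).1 (cS _ w1); rewrite (dFS _ w1) subrr.
rewrite -[F z](subrK (S z)) E addrC; congr (_ + _).
by apply/eqP; rewrite eq_complex /= ReFS // !eqxx.
Qed.

(** The radial limit of the derivative is computed twice: from the normal derivative and from the
    explicit kernels. Denominators are cleared so that the identity extends over the poles. *)
Lemma roof_circle_identity (alpha beta : R) :
  (forall z, cmod z < 1 -> dF z = alpha%:C * (2 * a / (a - z) ^+ 2) +
    beta%:C * (2 * b / (b - z) ^+ 2)) ->
  forall t, - c * (cmod P.[expi t] * cmod (expi t - a) ^+ 2 * cmod (expi t - b) ^+ 2) =
    2 * (alpha * cmod (expi t - b) ^+ 2 + beta * cmod (expi t - a) ^+ 2) * cmod Q.[expi t].
Proof.
move=> dFE t.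
(* At a pole both sides vanish, the left one because the point is [a] or [b]. *)
have [Qt|Qt] := eqVneq Q.[expi t] 0.
  rewrite Qt cmod0 mulr0; have [->|->] := Qab (cmod_expi t) (introT eqP Qt);
  by rewrite subrr cmod0 expr0n /= !(mulr0, mul0r).
pose dS z : C := alpha%:C * (2 * a / (a - z) ^+ 2) + beta%:C * (2 * b / (b - z) ^+ 2).
have good s : boundary_value h u s 0 /\ normal_derivative h u s c -> Q.[expi s] != 0 ->
    - c * (cmod P.[expi s] * cmod (expi s - a) ^+ 2 * cmod (expi s - b) ^+ 2) =
    2 * (alpha * cmod (expi s - b) ^+ 2 + beta * cmod (expi s - a) ^+ 2) * cmod Q.[expi s].
  move=> [_ nd] Qs; pose e : C := expi s; have e1 : cmod e = 1 := cmod_expi s.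
  have ea : e != a by apply/eqP => E; move: Qs; rewrite -/e E (eqP Qa) eqxx.
  have eb : e != b by apply/eqP => E; move: Qs; rewrite -/e E (eqP Qb) eqxx.
  have ccs d : e != d -> {for e, continuous (fun z : C => 2 * d / (d - z) ^+ 2)}.
    move=> ed; have de : (d - e) ^+ 2 != 0 by rewrite expf_neq0 // subr_eq0 eq_sym.
    have lin : {for e, continuous (fun z : C => d - z)} :=
      ccontD (@ccont_cst R d e) (ccontN (@ccont_id R e)).
    exact (ccontM (@ccont_cst R (2 * d) e) (@ccontV R (fun z => (d -
      z) ^+ 2) e de (ccontM lin lin))).
  have cdS : {for e, continuous (fun z => complex.Re (dS z * e))}.
    have cdS : {for e, continuous dS} :=
      ccontD (ccontM (@ccont_cst R alpha%:C e) (ccs a ea)) (ccontM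
      (@ccont_cst R beta%:C e) (ccs b eb)).
    exact (continuous_comp (ccontM cdS (@ccont_cst R e e)) (@continuous_Re R _)).
  have lim1 := continuous_radial e1 cdS.
  have lim2 := roof_radial_derivative nd Qs.
  have lim3 : complex.Re (dF (r%:C * e) * e) @[r --> at_left 1] --> complex.Re (dS e * e).
    refine (cvg_trans _ lim1); apply: near_eq_cvg; near=> r.
    have /andP[r0 r1] : 0 < r < 1 by near: r; apply: at_left1_lt.
    by rewrite dFE //; apply: cmod_radius; rewrite ltW.
  have E := cvg_unique (@Rhausdorff R) lim2 lim3.
  have da : cmod (e - a) != 0 by rewrite cmod_eq0 subr_eq0.
  have db : cmod (e - b) != 0 by rewrite cmod_eq0 subr_eq0.
  have q0 : cmod Q.[e] != 0 by rewrite cmod_eq0.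
  move: E; rewrite /dS mulrDl -(mulrA alpha%:C) -(mulrA beta%:C) ReD !ReZ.
  rewrite !kernel_derivative_circle // !ReN /= cmodM cmodV => E.
  have {}E : c * cmod P.[e] = - 2 * (alpha / cmod (e - a) ^+ 2 +
    beta / cmod (e - b) ^+ 2) * cmod Q.[e].
    have : c * (cmod P.[e] / cmod Q.[e]) * cmod Q.[e] = c * cmod P.[e] by rewrite mulrA divfK.
    by move=> <-; rewrite E; field; rewrite da db.
  have -> : - c * (cmod P.[e] * cmod (e - a) ^+ 2 * cmod (e - b) ^+ 2) =
    - (c * cmod P.[e]) * (cmod (e - a) ^+ 2 * cmod (e - b) ^+ 2) by ring.
  by rewrite E; field; rewrite da db.
pose A := P * ('X - a%:P) ^+ 2 * ('X - b%:P) ^+ 2.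
pose B1 := Q * ('X - b%:P) ^+ 2; pose B2 := Q * ('X - a%:P) ^+ 2.
have AE s : cmod A.[s] = cmod P.[s] * cmod (s - a) ^+ 2 * cmod (s - b) ^+ 2.
  by rewrite /A hornerM hornerM !horner_exp !hornerXsubC cmodM cmodM !cmodX.
have BE d s : cmod (Q * ('X - d%:P) ^+ 2).[s] = cmod Q.[s] * cmod (s - d) ^+ 2.
  by rewrite hornerM !horner_exp !hornerXsubC cmodM !cmodX.
pose Y e := - c * cmod A.[e] - (2 * alpha * cmod B1.[e] + 2 * beta * cmod B2.[e]).
have YE e : Y e = - c * (cmod P.[e] * cmod (e - a) ^+ 2 * cmod (e - b) ^+ 2) -
    2 * (alpha * cmod (e - b) ^+ 2 + beta * cmod (e - a) ^+ 2) * cmod Q.[e].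
  by rewrite /Y AE !BE; ring.
have cY : {for expi t, continuous Y}.
  have cp (p : {poly C}) : {for expi t, continuous (fun e => cmod p.[e])}.
    exact (continuous_comp (cder_continuous (cder_poly p (expi t))) (@continuous_cmod R _)).
  have ck (k : R) : {for expi t, continuous (fun e : C => k)} by exact: cst_continuous.
  exact (continuousB (continuousM (ck (- c)) (cp A))
    (continuousD (continuousM (ck (2 * alpha)) (cp B1)) (continuousM (ck (2 * beta))
      (cp B2)))).
(* [circle_density] extends an inequality; applied to the square of Y it yields an equality. *)
have : Y (expi t) * Y (expi t) <= 0.
  apply: (@circle_density R _ Q (fun e => Y e * Y e) t ubd _
    (continuousM cY cY) Qt) => s hs Qs.
  by rewrite YE good // subrr mulr0.
rewrite -expr2 => Y2; apply/eqP; rewrite -subr_eq0 -YE -sqrf_eq0; apply/eqP/le_anti.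
by rewrite Y2 sqr_ge0.
Unshelve. all: by end_near. Qed.

Lemma roof_model : exists (A B : C) (k d : R), [/\ A != 0, 0 < k,
  h @` @unit_disk R = [set A * gmap w + B | w in @strip R] &
  forall w, strip w -> f (A * gmap w + B) = k%:C * ccosh w + Complex 0 d].
Proof.
have [alpha [beta [gamma [al0 be0 FE dFE]]]] := roof_kernels.
have I := roof_circle_identity dFE.
have c_gt0 : 0 < - c by rewrite oppr_gt0 roof_normal_lt0.
have al : 0 < alpha.
  rewrite lt_def al0 andbT; apply/eqP => al.
  apply: (@atom_positive R P Q a b beta (- c)) => // t.
  by rewrite I al mul0r add0r.
have be : 0 < beta.
  rewrite lt_def be0 andbT; apply/eqP => be; have ba : b != a by rewrite eq_sym.
  apply: (@atom_positive R P Q b a alpha (- c)) => // t.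
  by rewrite mulrAC I be mul0r addr0.
have abR : 0 < cmod (a - b) by rewrite cmod_gt0 subr_eq0.
have D0 : 0 < cmod (a - b) ^+ 2 by rewrite exprn_gt0.
(* This value makes [strip_factor_circle] proportional to the weighted sum in [I], and equates the
   coefficients of e^w and e^-w in F. *)
pose tau := Num.sqrt (alpha / (beta * cmod (a - b) ^+ 2)).
have q0 : 0 < alpha / (beta * cmod (a - b) ^+ 2) by rewrite divr_gt0 // mulr_gt0.
have tau0 : 0 < tau by rewrite sqrtr_gt0.
have tau2 : beta * (tau ^+ 2 * cmod (a - b) ^+ 2) = alpha.
  by rewrite sqr_sqrtr ?ltW //; field; rewrite !gt_eqF.
pose L := strip_factor a b tau; pose lam := strip_lambda a b tau.
have l0 : lam != 0 := strip_lambda_neq0 b1 ab tau0.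
pose A := P * ('X - a%:P) ^+ 2 * ('X - b%:P) ^+ 2; pose B := Q * L ^+ 2.
have nz d z : cmod d = 1 -> cmod z < 1 -> ('X - d%:P).[z] != 0.
  by move=> d1 z1; rewrite hornerXsubC subr_eq0 circle_disk_neq.
have kk : 2 * beta / - c != 0 by rewrite !mulf_neq0 ?invr_eq0 ?pnatr_eq0 ?gt_eqF.
have [||||k k0 AB] := @proportional_modulus R A B (2 * beta / - c) _ kk.
- by rewrite /A !mulf_neq0 // polyXsubC_eq0.
- by move=> z z1; rewrite /A !hornerM !mulf_neq0 ?PD ?nz.
- by move=> z z1; rewrite /B !hornerM !mulf_neq0 ?QD ?strip_factor_disk.
- move=> t; apply: (mulfI (lt0r_neq0 c_gt0)).
  rewrite /A hornerM hornerM !horner_exp !hornerXsubC cmodM cmodM !cmodX I.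
  rewrite /B hornerM horner_exp cmodM cmodX strip_factor_circle ?cmod_expi //.
  by rewrite -[in LHS]tau2; field; rewrite ?oppr_eq0 c0.
have dh z : cmod z < 1 -> cder h z (k * L.[z] ^+ 2 / ((z - a) ^+ 2 * (z - b) ^+ 2)).
  move=> z1; suff <- : P.[z] / Q.[z] = k * L.[z] ^+ 2 / ((z - a) ^+ 2 * (z - b) ^+ 2)
    by exact: hD.
  have := congr1 (horner^~ z) AB;
    rewrite /A /B hornerM hornerM !horner_exp !hornerXsubC hornerZ hornerM horner_exp => E.
  have za : z - a != 0 by rewrite subr_eq0 circle_disk_neq.
  have zb : z - b != 0 by rewrite subr_eq0 circle_disk_neq.
  have Qz := QD z1.
  apply: (mulIf (_ : Q.[z] * ((z - a) ^+ 2 * (z - b) ^+ 2) != 0)).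
    by rewrite !mulf_neq0 ?expf_neq0.
  have -> : P.[z] / Q.[z] * (Q.[z] * ((z - a) ^+ 2 * (z - b) ^+ 2)) =
    P.[z] * (z - a) ^+ 2 * (z - b) ^+ 2 by field.
  by rewrite E; field; rewrite za zb.
have sc := strip_conformal a1 b1 ab tau0 dh.
set A' := 2 * k * lam / (a - b) in sc; set B' := _ - _ in sc.
have two0 : (2 : C) != 0 by rewrite pnatr_eq0.
have A'0 : A' != 0 by apply: mulf_neq0;
  [exact: mulf_neq0 (mulf_neq0 two0 k0) l0|rewrite invr_eq0 subr_eq0].
pose X : C := (a + b) / (a - b).
have ReX : complex.Re X = 0 := poisson_kernel_circle b1 a1 ab.
(* Both exponentials in F have the coefficient 2 beta tau, and cosh is half their sum. The imaginary
   constant collects the opposite constants of the two kernels, weighted by alpha and beta, and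
   gamma. *)
pose kap := 4 * beta * tau; have kap0 : 0 < kap by rewrite !mulr_gt0.
exists A', B', kap, ((alpha - beta) * complex.Im X + gamma); split=> //.
- apply/seteqP; split=> [_ [z z1 <-]|_ [w sw <-]].
    have [w sw ew] := cexp_strip_surj (Re_disk_to_half_plane_gt0 a1 b1 ab tau0 z1).
    exists w => //; rewrite -sc // ew disk_to_half_planeK //.
  exists (half_plane_to_disk a b tau (cexp w)); last by rewrite sc.
  exact: cmod_half_plane_to_disk (Re_cexp_gt0 sw).
move=> w sw; rewrite -sc //; have e0 := Re_cexp_gt0 sw.
set z := half_plane_to_disk a b tau (cexp w).
have z1 : cmod z < 1 := cmod_half_plane_to_disk a1 b1 ab tau0 e0.
rewrite -/(F z) FE // (kernel_a_half_plane a1 b1 ab tau0 (circle_disk_neq a1 z1)).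
rewrite (kernel_b_half_plane b1 ab tau0 (circle_disk_neq a1 z1) (circle_disk_neq b1 z1)) -/X.
rewrite half_plane_to_diskK // /ccosh cexpN; have := cexp_neq0 w; move: (cexp w) => e ene.
have -> : 2 / (tau * cmod (a - b) ^+ 2) = 2 * beta * tau / alpha.
  by rewrite -tau2; field; rewrite !gt_eqF.
have XE : X = Complex 0 (complex.Im X) by move: X ReX => [x y] /= ->.
have -> : Complex 0 ((alpha - beta) * complex.Im X + gamma) = (alpha%:C - beta%:C) * X +
  Complex 0 gamma.
  by rewrite XE; apply/eqP; rewrite eq_complex /=; apply/andP; split; apply/eqP; ring.
have alC : alpha%:C != 0 by rewrite (fmorph_eq0 (real_complex R)) gt_eqF.
rewrite /kap !(realcM, realcV, realc_nat); field; rewrite ene alC //.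
Qed.

End RoofFunction.

Theorem theorem6p1 (R : realType) (Om : set R[i]) (h : R[i] -> R[i])
    (u v : R[i] -> R) :
  conformal_map_onto h Om ->
  smirnov h ->
  roof_function Om h u ->
  holomorphic_on Om (fun z => Complex (u z) (v z)) ->
  rational_deriv_two_boundary_poles h ->
  exists (a b : R[i]) (c d : R),
    [/\ a != 0, 0 < c,
        Om = [set a * gmap w + b | w in @strip R]
      & forall w, strip w ->
          Complex (u (a * gmap w + b)) (v (a * gmap w + b))
          = c%:C * ccosh w + Complex 0 d].
Proof.
move=> [[_ hder] [_ hOm]] [l [phi [l1 _ hexp]]] [[oOm harm] upos bv [c [c0 nd]]] [_ fder].
move=> [P [Q [Q0 cop h'E [a [b [ab [a1 b1] Qa Qb Qab]]]]]].
have h'0 z : cmod z < 1 -> P.[z] / Q.[z] != 0.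
  move=> z1; rewrite -h'E // hexp // mulf_neq0 ?cexp_neq0 //.
  by rewrite -cmod_eq0 l1 oner_eq0.
(* A root of [Q] in the disk would give the quotient the default value 0, so the nonvanishing of h',
   read off its outer representation, excludes the roots of both polynomials. *)
have PQ z : cmod z < 1 -> P.[z] != 0 /\ Q.[z] != 0.
  by move=> /h'0; rewrite mulf_eq0 invr_eq0 negb_or => /andP.
have P0 : P != 0.
  have c00 : cmod (0 : R[i]) < 1 by rewrite cmod0.
  by apply/eqP => P0; have := (PQ 0 c00).1; rewrite P0 horner0 eqxx.
rewrite -hOm.
apply: (@roof_model R Om h u v P Q a b c) => //.
- by move=> z z1; rewrite -h'E //; apply/derivable_cder/hder.
- by move=> z /PQ[].
- by move=> z /PQ[].
- by move=> z z1; rewrite -hOm; exists z.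
- by move=> z Oz; apply/derivable_cder/fder.
- by move=> z /harm[_ _ _ []].
- by move=> z /harm[_ _ _ []].
- exact: ae_circleI.
Qed.
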